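(* For each $n \geq 1$, the notion of an $n$-Drinfeld vector bundle is Zariski local on the class of all locally noetherian schemes. That is: let $n \ge 1$, let $X$ be any locally noetherian scheme, with ring of sections $\mathcal R(u)$ over each open affine set $u \subseteq X$, let $X = \bigcup_{v \in V} v$ be any open affine covering of $X$, and let $\mathcal M$ be any quasi-coherent sheaf on $X$. If $\mathcal M(v)$ is a flat $n$-Mittag-Leffler $\mathcal R(v)$-module for every $v \in V$, then $\mathcal M(u)$ is a flat $n$-Mittag-Leffler $\mathcal R(u)$-module for every open affine set $u \subseteq X$ (i.e., $\mathcal M$ is an $n$-Drinfeld vector bundle).
   Context: Let $R$ be a commutative ring. For a class $\mathcal Q$ of $R$-modules, an $R$-module $M$ is $\mathcal Q$-Mittag-Leffler if for every family $(Q_i \mid i\in I)$ of elements of $\mathcal Q$ the canonical map $M \otimes_R \prod_{i\in I} Q_i \to \prod_{i \in I} M\otimes_R Q_i$, $m \otimes (q_i)_{i\in I} \mapsto (m\otimes q_i)_{i\in I}$, is injective. Let $\mathcal F_n$ denote the class of all $R$-modules of weak (flat) dimension $\le n$, and let $\mathcal Q_n = (\mathcal F_n)^\intercal$ be the class of all $R$-modules $D$ such that $\operatorname{Tor}_1^R(B,D)=0$ for all $B \in \mathcal F_n$. An $R$-module is flat $n$-Mittag-Leffler if it is flat and $\mathcal Q_n$-Mittag-Leffler. A quasi-coherent sheaf $\mathcal M$ on a scheme $X$ with structure sheaf $\mathcal R$ is an $n$-Drinfeld vector bundle if for each open affine set $u$ of $X$, the $\mathcal R(u)$-module $\mathcal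 M(u)$ is flat $n$-Mittag-Leffler. A scheme $X$ is locally noetherian if $\mathcal R(u)$ is a noetherian ring for each open affine set $u$ of $X$. *)

(* Defs.v *)
From HB Require Import structures.
From mathcomp Require Import all_boot all_order all_algebra.
From mathcomp Require Import all_classical topology.

Set Implicit Arguments.
Unset Strict Implicit.
Unset Printing Implicit Defensive.

Import GRing.Theory.
Local Open Scope classical_set_scope.
Local Open Scope ring_scope.
Local Open Scope quotient_scope.

(* Rings are [comPzRingType]s: the zero ring must be allowed, since it is the
   ring of sections over the empty set. *)

Definition is_ideal (A : comPzRingType) (I : set A) : Prop :=
  [/\ I 0, forall x y, I x -> I y -> I (x + y) & forall a x, I x -> I (a * x)].

Definition noetherian (A : comPzRingType) : Prop :=
  forall I : set A, is_ideal I ->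
    exists (n : nat) (g : 'I_n -> A),
      I = [set x | exists c : 'I_n -> A, x = \sum_(i < n) c i * g i].

Definition exact_at (U V W : zmodType) (f : U -> V) (g : V -> W) : Prop :=
  forall y, g y = 0 <-> exists x, f x = y.

(* The tensor product M (x)_R N: formal sums of pairs (m, n), written as lists,
   modulo the congruence generated by the bilinearity relations. *)
Section Tensor.
Variables (R : comPzRingType) (M N : lmodType R).

Inductive tensor_rel : seq (M * N) -> seq (M * N) -> Prop :=
| trel_refl s : tensor_rel s s
| trel_sym s t : tensor_rel s t -> tensor_rel t s
| trel_trans s t u : tensor_rel s t -> tensor_rel t u -> tensor_rel s u
| trel_cat s s' t t' :
    tensor_rel s s' -> tensor_rel t t' -> tensor_rel (s ++ t) (s' ++ t')
| trel_catC s t : tensor_rel (s ++ t) (t ++ s)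
| trel_0 n : tensor_rel [:: (0, n)] [::]
| trel_Dl m m' n : tensor_rel [:: (m + m', n)] [:: (m, n); (m', n)]
| trel_Dr m n n' : tensor_rel [:: (m, n + n')] [:: (m, n); (m, n')]
| trel_Z a m n : tensor_rel [:: (a *: m, n)] [:: (m, a *: n)].

Definition tensor_eqb : rel (seq (M * N)) := fun s t => `[< tensor_rel s t >].

Lemma tensor_eqb_equiv : equiv_class_of tensor_eqb.
Proof.
split=> [s|s t|t s u].
- exact/asboolP/trel_refl.
- by apply/asboolP/asboolP; apply: trel_sym.
- by move=> /asboolP st /asboolP tu; apply/asboolP; apply: trel_trans st tu.
Qed.

Definition tensor_equiv : equiv_rel (seq (M * N)) :=
  EquivRelPack tensor_eqb_equiv.

Definition tensor : Type := {eq_quot tensor_equiv}.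
HB.instance Definition _ := Choice.on tensor.
HB.instance Definition _ := EqQuotient.on tensor.

Definition pure_tensor (m : M) (n : N) : tensor := \pi_tensor [:: (m, n)].

Definition scale_sum (a : R) (s : seq (M * N)) : seq (M * N) :=
  [seq (a *: p.1, p.2) | p <- s].

Definition tensor_zero : tensor := \pi_tensor [::].
Definition tensor_add (x y : tensor) : tensor := \pi_tensor (repr x ++ repr y).
Definition tensor_scale (a : R) (x : tensor) : tensor :=
  \pi_tensor (scale_sum a (repr x)).
Definition tensor_opp : tensor -> tensor := tensor_scale (-1).

Lemma tensor_piP s t : tensor_rel s t <-> \pi_tensor s = \pi_tensor t.
Proof.
split=> [st|/eqquotP /asboolP //].
by apply/eqquotP/asboolP.
Qed.

Lemma scale_sum_rel a s t :
  tensor_rel s t -> tensor_rel (scale_sum a s) (scale_sum a t).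
Proof.
elim=> {s t} [s|s t _|s t u _ st _|s s' t t' _ ss' _|s t|n|m m' n|m n n'|b m n]
    /=; rewrite /scale_sum ?map_cat /=.
- exact: trel_refl.
- exact: trel_sym.
- exact: trel_trans.
- exact: trel_cat.
- exact: trel_catC.
- by rewrite scaler0; apply: trel_0.
- by rewrite scalerDr; apply: trel_Dl.
- exact: trel_Dr.
- by rewrite scalerA mulrC -scalerA; apply: trel_Z.
Qed.

Lemma tensor_addE s t :
  tensor_add (\pi_tensor s) (\pi_tensor t) = \pi_tensor (s ++ t).
Proof. by apply/tensor_piP; apply: trel_cat; apply/tensor_piP; rewrite reprK. Qed.

Lemma tensor_scaleE a s :
  tensor_scale a (\pi_tensor s) = \pi_tensor (scale_sum a s).
Proof. by apply/tensor_piP/scale_sum_rel/tensor_piP; rewrite reprK. Qed.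

Lemma tensor_ind (P : tensor -> Prop) :
  (forall s, P (\pi_tensor s)) -> forall x, P x.
Proof. by move=> H x; rewrite -[x]reprK. Qed.

Lemma tensor_addA : associative tensor_add.
Proof.
elim/tensor_ind=> s; elim/tensor_ind=> t; elim/tensor_ind=> u.
by rewrite !tensor_addE catA.
Qed.

Lemma tensor_addC : commutative tensor_add.
Proof.
elim/tensor_ind=> s; elim/tensor_ind=> t; rewrite !tensor_addE.
exact/tensor_piP/trel_catC.
Qed.

Lemma tensor_add0 : left_id tensor_zero tensor_add.
Proof. by elim/tensor_ind=> s; rewrite tensor_addE. Qed.

Lemma tensor_scaleDl x a b :
  tensor_scale (a + b) x = tensor_add (tensor_scale a x) (tensor_scale b x).
Proof.
elim/tensor_ind: x => s; rewrite !tensor_scaleE tensor_addE.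
apply/tensor_piP; elim: s => [|[m n] s IHs] /=; first exact: trel_refl.
have step : tensor_rel ([:: ((a + b) *: m, n)] ++ scale_sum (a + b) s)
    ([:: (a *: m, n); (b *: m, n)] ++ (scale_sum a s ++ scale_sum b s)).
  by apply: trel_cat IHs; rewrite scalerDl; apply: trel_Dl.
apply: trel_trans step _.
apply: (trel_cat (s := [:: (a *: m, n)]) (s' := [:: (a *: m, n)])).
  exact: trel_refl.
rewrite -[X in tensor_rel _ (_ ++ X)]cat1s [X in tensor_rel _ X]catA.
apply: (trel_cat (s := [:: (b *: m, n)] ++ scale_sum a s)).
  exact: trel_catC.
exact: trel_refl.
Qed.

Lemma tensor_scale0 x : tensor_scale 0 x = tensor_zero.
Proof.
elim/tensor_ind: x => s; rewrite tensor_scaleE; apply/tensor_piP.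
elim: s => [|[m n] s IHs] /=; first exact: trel_refl.
rewrite scale0r -cat1s -[[::]]/([::] ++ [::]).
by apply: trel_cat; [apply: trel_0 | ].
Qed.

Lemma tensor_scale1 : left_id 1 tensor_scale.
Proof.
elim/tensor_ind=> s; rewrite tensor_scaleE; congr (\pi_tensor _).
by rewrite -[RHS]map_id; apply: eq_map => -[m n] /=; rewrite scale1r.
Qed.

Lemma tensor_addN : left_inverse tensor_zero tensor_opp tensor_add.
Proof.
move=> x; rewrite -{2}[x]tensor_scale1 -tensor_scaleDl addNr.
exact: tensor_scale0.
Qed.

HB.instance Definition _ := GRing.isZmodule.Build tensor
  tensor_addA tensor_addC tensor_add0 tensor_addN.

Lemma tensor_scaleA a b x :
  tensor_scale a (tensor_scale b x) = tensor_scale (a * b) x.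
Proof.
elim/tensor_ind: x => s; rewrite !tensor_scaleE; congr (\pi_tensor _).
by rewrite /scale_sum -map_comp; apply: eq_map => p /=; rewrite scalerA.
Qed.

Lemma tensor_scaleDr : right_distributive tensor_scale +%R.
Proof.
move=> a; elim/tensor_ind=> s; elim/tensor_ind=> t.
by rewrite /GRing.add /= !(tensor_scaleE, tensor_addE) /scale_sum map_cat.
Qed.

HB.instance Definition _ := GRing.Zmodule_isLmodule.Build R tensor
  tensor_scaleA tensor_scale1 tensor_scaleDr tensor_scaleDl.

Lemma tensor_piE s : \pi_tensor s = \sum_(p <- s) pure_tensor p.1 p.2 :> tensor.
Proof.
elim: s => [|[m n] s IHs]; first by rewrite big_nil.
by rewrite big_cons -IHs /GRing.add /= tensor_addE.
Qed.

Lemma pureDl m m' n : pure_tensor (m + m') n = pure_tensor m n + pure_tensor m' n.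
Proof. by rewrite /GRing.add /= tensor_addE; apply/tensor_piP/trel_Dl. Qed.

Lemma pureDr m n n' : pure_tensor m (n + n') = pure_tensor m n + pure_tensor m n'.
Proof. by rewrite [RHS]/GRing.add /= tensor_addE; apply/tensor_piP/trel_Dr. Qed.

Lemma pureZl a m n : pure_tensor (a *: m) n = a *: pure_tensor m n.
Proof. by rewrite [RHS]/GRing.scale /= tensor_scaleE. Qed.

Lemma pureZr a m n : pure_tensor m (a *: n) = a *: pure_tensor m n.
Proof. by rewrite -pureZl; apply/esym/tensor_piP/trel_Z. Qed.

End Tensor.

Arguments pure_tensor {R M N}.

Section TensorMap.
Variables (R : comPzRingType) (M M' N N' : lmodType R).
Variables (f : {linear M -> M'}) (g : {linear N -> N'}).

Definition tensor_map (x : tensor M N) : tensor M' N' :=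
  \pi_(tensor M' N') [seq (f p.1, g p.2) | p <- repr x].

Lemma tensor_map_rel s t : tensor_rel s t ->
  tensor_rel [seq (f p.1, g p.2) | p <- s] [seq (f p.1, g p.2) | p <- t].
Proof.
elim=> {s t} [s|s t _|s t u _ st _|s s' t t' _ ss' _|s t|n|m m' n|m n n'|b m n]
    /=; rewrite ?map_cat /=.
- exact: trel_refl.
- exact: trel_sym.
- exact: trel_trans.
- exact: trel_cat.
- exact: trel_catC.
- by rewrite linear0; apply: trel_0.
- by rewrite linearD; apply: trel_Dl.
- by rewrite linearD; apply: trel_Dr.
- by rewrite !linearZ; apply: trel_Z.
Qed.

Lemma tensor_map_pi s :
  tensor_map (\pi_(tensor M N) s) =
    \pi_(tensor M' N') [seq (f p.1, g p.2) | p <- s].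
Proof. by apply/tensor_piP/tensor_map_rel/tensor_piP; rewrite reprK. Qed.

Lemma tensor_map_pure m n : tensor_map (pure_tensor m n) = pure_tensor (f m) (g n).
Proof. exact: tensor_map_pi. Qed.

Lemma tensor_map_linear : linear tensor_map.
Proof.
move=> a; elim/tensor_ind=> s; elim/tensor_ind=> t.
rewrite /GRing.add /GRing.scale /=.
rewrite !(tensor_scaleE, tensor_addE, tensor_map_pi) map_cat.
congr (\pi_(_) (_ ++ _)); rewrite /scale_sum -!map_comp.
by apply: eq_map => p /=; rewrite linearZ.
Qed.

HB.instance Definition _ := GRing.isLinear.Build R (tensor M N) (tensor M' N')
  _ tensor_map tensor_map_linear.

End TensorMap.

(* Product of an arbitrary family of modules. *)
Section Product.
Variables (R : comPzRingType) (I : Type) (Q : I -> lmodType R).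

Definition module_prod : Type := forall i, Q i.
HB.instance Definition _ := gen_eqMixin module_prod.
HB.instance Definition _ := gen_choiceMixin module_prod.

Implicit Types p q r : module_prod.

Let padd p q : module_prod := fun i => p i + q i.
Let popp p : module_prod := fun i => - p i.
Let pzero : module_prod := fun=> 0.
Let pscale (a : R) p : module_prod := fun i => a *: p i.

Let paddA : associative padd.
Proof. by move=> p q r; apply: functional_extensionality_dep => i; apply: addrA. Qed.
Let paddC : commutative padd.
Proof. by move=> p q; apply: functional_extensionality_dep => i; apply: addrC. Qed.
Let padd0 : left_id pzero padd.
Proof. by move=> p; apply: functional_extensionality_dep => i; apply: add0r. Qed.
Let paddN : left_inverse pzero popp padd.
Proof. by move=> p; apply: functional_extensionality_dep => i; apply: addNr. Qed.

HB.instance Definition _ := GRing.isZmodule.Build module_prod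
  paddA paddC padd0 paddN.

Let pscaleA a b p : pscale a (pscale b p) = pscale (a * b) p.
Proof. by apply: functional_extensionality_dep => i; apply: scalerA. Qed.
Let pscale1 : left_id 1 pscale.
Proof. by move=> p; apply: functional_extensionality_dep => i; apply: scale1r. Qed.
Let pscaleDr : right_distributive pscale +%R.
Proof.
by move=> a p q; apply: functional_extensionality_dep => i; apply: scalerDr.
Qed.
Let pscaleDl p : {morph pscale^~ p : a b / a + b}.
Proof. by move=> a b; apply: functional_extensionality_dep => i; apply: scalerDl. Qed.

HB.instance Definition _ := GRing.Zmodule_isLmodule.Build R module_prod
  pscaleA pscale1 pscaleDr pscaleDl.

Definition module_proj (i : I) (p : module_prod) : Q i := p i.

Lemma module_proj_linear i : linear (module_proj i).
Proof. by []. Qed.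

HB.instance Definition _ i := GRing.isLinear.Build R module_prod (Q i) _
  (module_proj i) (module_proj_linear i).

End Product.

Section Modules.
Variable R : comPzRingType.
Implicit Types (M N B D P : lmodType R) (Q : lmodType R -> Prop) (n : nat).

Definition flat M : Prop :=
  forall N N' (f : {linear N -> N'}),
    injective f -> injective (tensor_map (idfun : {linear M -> M}) f).

Definition projective P : Prop :=
  forall N N' (g : {linear N -> N'}) (f : {linear P -> N'}),
    (forall y, exists x, g x = y) ->
    exists h : {linear P -> N}, forall x, g (h x) = f x.

(* ... -> C_2 -> C_1 -> C_0 -> M -> 0 *)
Record resolution M := Resolution {
  res_obj :> nat -> lmodType R;
  res_d : forall i, {linear res_obj i.+1 -> res_obj i};
  res_aug : {linear res_obj 0%N -> M};
  res_aug_surj : forall m, exists x, res_aug x = m;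
  res_exact0 : exact_at (res_d 0) res_aug;
  res_exactS : forall i, exact_at (res_d i.+1) (res_d i)
}.

Definition weak_dim_le n M : Prop :=
  exists C : resolution M,
    (forall i, (i <= n)%N -> flat (C i)) /\
    (forall i, (n < i)%N -> forall x : C i, x = 0).

(* Tor_1^R(B, D) = 0: the complex P (x) D has no homology in degree 1, for the
   projective resolutions P of B. *)
Definition Tor1_eq0 B D : Prop :=
  forall P : resolution B, (forall i, projective (P i)) ->
    exact_at (tensor_map (res_d P 1) (idfun : {linear D -> D}))
             (tensor_map (res_d P 0) (idfun : {linear D -> D})).

Definition Qclass n D : Prop := forall B, weak_dim_le n B -> Tor1_eq0 B D.

Definition tensor_prod_map M (I : Type) (Q : I -> lmodType R)
    (x : tensor M (module_prod Q)) : module_prod (fun i => tensor M (Q i)) :=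
  fun i => tensor_map (idfun : {linear M -> M}) (module_proj (Q := Q) i) x.

Definition mittag_leffler Q M : Prop :=
  forall (I : Type) (F : I -> lmodType R),
    (forall i, Q (F i)) -> injective (tensor_prod_map (M := M) (Q := F)).

Definition flat_mittag_leffler n M : Prop :=
  flat M /\ mittag_leffler (Qclass n) M.

End Modules.

(* B is the localization A_a, through phi. *)
Definition localization_away (A B : comPzRingType) (phi : {rmorphism A -> B})
    (a : A) : Prop :=
  [/\ exists b, phi a * b = 1,
      forall b, exists x k, phi a ^+ k * b = phi x
    & forall x y, phi x = phi y -> exists k, a ^+ k * x = a ^+ k * y].

(* The B-module N' is the localization N_a of the A-module N, through the
   phi-semilinear map iota; B plays the role of A_a. *)
Definition module_localization_away (A B : comPzRingType)
    (phi : {rmorphism A -> B}) (N : lmodType A) (N' : lmodType B)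
    (iota : N -> N') (a : A) : Prop :=
  [/\ exists b, phi a * b = 1,
      forall y, exists x k, phi a ^+ k *: y = iota x
    & forall x y, iota x = iota y -> exists k, a ^+ k *: x = a ^+ k *: y].

Record spectrum (A : comPzRingType) := PrimeIdeal {
  prime_set :> set A;
  prime_ideal : is_ideal prime_set;
  prime_proper : ~ prime_set 1;
  primeP : forall a b, prime_set (a * b) -> prime_set a \/ prime_set b
}.

Section Zariski.
Variable A : comPzRingType.

HB.instance Definition _ := gen_eqMixin (spectrum A).
HB.instance Definition _ := gen_choiceMixin (spectrum A).

Definition vanishing (E : set A) : set (spectrum A) := [set p | E `<=` p].

Definition zariski_open : set_system (spectrum A) :=
  [set U | exists E, U = ~` vanishing E].

Lemma zariski_openT : zariski_open setT.
Proof.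
exists setT; apply/seteqP; split=> // p _ /= pT.
by apply: (@prime_proper _ p); apply: pT.
Qed.

Lemma zariski_openI : setI_closed zariski_open.
Proof.
move=> _ _ [E ->] [F ->].
exists [set x | exists a b, [/\ E a, F b & x = a * b]].
rewrite -setCU; congr (~` _); apply/seteqP; split=> p /=.
  have [_ _ pM] := prime_ideal p.
  move=> [Ep|Fp] _ [a [b [Ea Fb ->]]]; last exact/pM/Fp.
  by rewrite mulrC; apply/pM/Ep.
move=> EFp; apply: contrapT => /not_orP [nE nF].
have /existsNP [a /not_implyP [Ea npa]] := nE.
have /existsNP [b /not_implyP [Fb npb]] := nF.
have pab : prime_set p (a * b) by apply: EFp; exists a, b.
by have [] := primeP pab.
Qed.

Lemma zariski_open_bigU (I : Type) (f : I -> set (spectrum A)) :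
  (forall i, zariski_open (f i)) -> zariski_open (\bigcup_i f i).
Proof.
move=> /choice [E fE]; exists (\bigcup_i E i).
rewrite (eq_bigcupr (fun i _ => fE i)) -setC_bigcap; congr (~` _).
apply/seteqP; split=> p /=; first by move=> Ep x [i _ Eix]; apply: (Ep i).
by move=> Ep i _ x Eix; apply: Ep; exists i.
Qed.

HB.instance Definition _ := isOpenTopological.Build (spectrum A)
  zariski_openT zariski_openI zariski_open_bigU.

Definition basic_open (a : A) : set (spectrum A) := [set p | ~ prime_set p a].

End Zariski.

Record opens (X : topologicalType) := Opens {
  opens_set :> set X;
  opens_open : open opens_set
}.

Definition opensI (X : topologicalType) (U V : opens X) : opens X :=
  Opens (openI (opens_open U) (opens_open V)).

Lemma opensIl (X : topologicalType) (U V : opens X) : opensI U V `<=` U.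
Proof. by move=> x []. Qed.

Lemma opensIr (X : topologicalType) (U V : opens X) : opensI U V `<=` V.
Proof. by move=> x []. Qed.

Definition is_sheaf (X : topologicalType) (F : opens X -> Type)
    (rho : forall U V : opens X, V `<=` U -> F U -> F V) : Prop :=
  [/\ forall (U : opens X) (UU : U `<=` U) s, rho U U UU s = s,
      forall (U V W : opens X) (VU : V `<=` U) (WV : W `<=` V) (WU : W `<=` U) s,
        rho V W WV (rho U V VU s) = rho U W WU s
    & forall (U : opens X) (I : Type) (W : I -> opens X)
          (WU : forall i, W i `<=` U),
        U `<=` \bigcup_i W i ->
        forall s : forall i, F (W i),
          (forall i j, rho _ _ (@opensIl _ (W i) (W j)) (s i)
                     = rho _ _ (@opensIr _ (W i) (W j)) (s j)) ->
          exists! t : F U, forall i, rho _ _ (WU i) t = s i].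

Record ringed_space := RingedSpace {
  rs_top :> topologicalType;
  rs_ring : opens rs_top -> comPzRingType;
  rs_res : forall U V : opens rs_top, V `<=` U -> {rmorphism rs_ring U -> rs_ring V};
  rs_sheaf : is_sheaf (fun U V VU => rs_res VU : _ -> _)
}.

(* An isomorphism of ringed spaces from Spec A onto the open subspace U.  The
   structure sheaf of Spec A is the sheaf whose sections over each D(a) are A_a,
   with the canonical restrictions; as the D(a) form a base, the isomorphism of
   sheaves amounts to one of A_a with the sections over the image of D(a) for
   every a, compatibly with the maps from A. *)
Record affine_chart (X : ringed_space) (U : opens X) := AffineChart {
  ch_ring : comPzRingType;
  ch_map : spectrum ch_ring -> X;
  ch_cts : continuous ch_map;
  ch_inj : injective ch_map;
  ch_open : forall E, open E -> open (ch_map @` E);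
  ch_range : range ch_map = U;
  ch_mor : {rmorphism ch_ring -> rs_ring U};
  ch_loc : forall (a : ch_ring) (V : opens X) (VU : V `<=` U),
    V = ch_map @` basic_open a :> set X ->
    localization_away (rs_res VU \o ch_mor : {rmorphism _ -> _}) a
}.

Arguments ch_map {X U} _ _.
Arguments ch_mor {X U} _.

Definition affine (X : ringed_space) (U : opens X) : Prop :=
  inhabited (affine_chart U).

Record scheme := Scheme {
  sch_rs :> ringed_space;
  sch_affine : forall x : sch_rs, exists U : opens sch_rs, opens_set U x /\ affine U
}.

Definition locally_noetherian (X : scheme) : Prop :=
  forall U : opens X, affine U -> noetherian (rs_ring U).

Record sheaf_of_modules (X : ringed_space) := SheafOfModules {
  sm_mod :> forall U : opens X, lmodType (rs_ring U);
  sm_res : forall (U V : opens X) (VU : V `<=` U),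
    {linear sm_mod U -> sm_mod V | rs_res VU \; *:%R};
  sm_sheaf : is_sheaf (fun U V VU => sm_res VU : _ -> _)
}.

(* M is covered by affine charts Spec A -> U over which it is the sheaf
   associated with an A-module N, i.e. the one whose sections over each D(a) are
   N_a, with the canonical restrictions. *)
Definition quasi_coherent (X : scheme) (M : sheaf_of_modules X) : Prop :=
  forall x : X, exists (U : opens X) (c : affine_chart U),
    opens_set U x /\
    exists (N : lmodType (ch_ring c))
           (iota : {linear N -> M U | ch_mor c \; *:%R}),
      forall (a : ch_ring c) (V : opens X) (VU : V `<=` U),
        V = ch_map c @` basic_open a :> set X ->
        module_localization_away
          (rs_res VU \o ch_mor c : {rmorphism _ -> _}) (sm_res M VU \o iota) a.

Definition drinfeld_vector_bundle (n : nat) (X : scheme)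
    (M : sheaf_of_modules X) : Prop :=
  forall U : opens X, affine U -> flat_mittag_leffler n (M U).

(* Main.v *)
Require Import Defs.
From HB Require Import structures.
From mathcomp Require Import all_boot all_order all_algebra.
From mathcomp Require Import all_classical topology zify.

Set Implicit Arguments.
Unset Strict Implicit.
Unset Printing Implicit Defensive.

Import GRing.Theory.
Local Open Scope classical_set_scope.
Local Open Scope ring_scope.
Local Open Scope quotient_scope.

(** Everything is reduced to systems of linear equations.  A module M is flat
    if and only if every finite system of linear relations alpha m = 0 in M
    has a reason in the ring: m = a m' with alpha a = 0 (flat_eqflat,
    eqflat_flat).  If M is flat, then sum m_i (x) q_i = 0 means that m = a m'
    with a^T q = 0, and M is Q-Mittag-Leffler if and only if for every finite
    tuple m a single factorization m = a m' serves all q at once: a^T q = 0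
    whenever q is a tuple in a module of Q with sum m_i (x) q_i = 0
    (mittag_leffler_eq_ml, eq_ml_mittag_leffler).  Likewise the elements of
    Tor_1(B, D) are represented by triples (a, b, d) with a b = 0 and
    a^T d = 0, for tuples b in B and d in D, and the vanishing of such a
    triple is again solvability of linear equations (Tor1_tor_trivial,
    tor_trivial_Tor1).

    For a localization A -> A_f, modules of weak dimension at most n localize
    and restrict to such modules.  Clearing denominators in the triples gives:
    if D lies in Q_n(A), then D_f lies in Q_n(A_f) (Qclass_bc), and if D lies
    in Q_n(A_f), then D lies in Q_n(A) (Qclass_restr).  The second fact makes
    flat n-Mittag-Leffler modules localize (flat_ml_localize).  The first one
    makes the notion descend along a family of f generating the unit ideal
    (flat_ml_descent).  For each f, a factorization of the localized tuple in
    M_f becomes, after clearing denominators, a relation in M; by flatness,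
    any factorization of m over A can be refined to one that works for q up to
    a power of f.  The f for which this refinement is always possible form an
    ideal, so it is possible for f = 1.  The product of the Q_i is never
    localized, which matters because localization does not commute with
    infinite products.

    On the scheme, M(U) -> M(D(s)) is a localization at s for every affine
    open U and every section s over U: quasi-coherence gives this over some
    affine neighbourhoods, it passes to non-vanishing loci
    (localizing_nonvan), and it is glued over a finite cover of U by such loci
    (mod_localizing_glue, affine_localizing).  A point x common to U and a
    member v of the given covering has a neighbourhood D(g), for g a section
    over v, inside U, and then a neighbourhood D(f), for f a section over U,
    inside D(g).  There M is flat n-Mittag-Leffler by localization from v, in
    two steps, and the f obtained in this way generate the unit ideal of the
    ring of sections over U, so descent applies. *)

(** * Linear combinations with coefficients in a matrix *)

Section LinearCombinations.
Variable R : comPzRingType.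

(** Matrices act on tuples of module elements.  The index types are arbitrary
    finite types, so that block matrices are indexed by sum types and no
    renumbering is needed. *)
Definition lc (M : lmodType R) (I J : finType) (a : I -> J -> R) (x : J -> M) :
  I -> M := fun i => \sum_j a i j *: x j.

Definition cmul (I J K : finType) (a : I -> J -> R) (b : J -> K -> R) :
  I -> K -> R := fun i k => \sum_j a i j * b j k.

Definition tr (I J : Type) (a : I -> J -> R) : J -> I -> R := fun j i => a i j.

Definition blk_row (I J J' : Type) (a : I -> J -> R) (b : I -> J' -> R) :
  I -> J + J' -> R := fun i s => match s with inl j => a i j | inr j => b i j end.

Definition blk_col (I I' : Type) (T : Type) (a : I -> T) (b : I' -> T) :
  I + I' -> T := fun s => match s with inl j => a j | inr j => b j end.

Variable M N : lmodType R.

Lemma lcA (I J K : finType) (a : I -> J -> R) (b : J -> K -> R) (x : K -> M) i :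
  lc a (lc b x) i = lc (cmul a b) x i.
Proof.
rewrite /lc /cmul; under eq_bigr => j _ do rewrite scaler_sumr.
rewrite exchange_big; apply: eq_bigr => k _ /=; rewrite scaler_suml.
by apply: eq_bigr => j _; rewrite scalerA.
Qed.

Lemma lc0 (I J : finType) (a : I -> J -> R) (x : J -> M) i :
  (forall j, x j = 0) -> lc a x i = 0.
Proof. by move=> x0; rewrite /lc big1 // => j _; rewrite x0 scaler0. Qed.

Lemma eq_lc (I J : finType) (a b : I -> J -> R) (x y : J -> M) i :
  (forall i j, a i j = b i j) -> (forall j, x j = y j) -> lc a x i = lc b y i.
Proof. by move=> ab xy; apply: eq_bigr => j _; rewrite ab xy. Qed.

Lemma eq_lcr (I J : finType) (a : I -> J -> R) (x y : J -> M) i :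
  (forall j, x j = y j) -> lc a x i = lc a y i.
Proof. exact: eq_lc. Qed.

Lemma lc_tr_cmul (I J K : finType) (a : I -> J -> R) (b : J -> K -> R)
    (x : I -> M) k :
  lc (tr (cmul a b)) x k = lc (tr b) (lc (tr a) x) k.
Proof.
rewrite lcA; apply: eq_lc => // {}k i.
by rewrite /tr /cmul; apply: eq_bigr => j _; rewrite mulrC.
Qed.

Lemma lcD (I J : finType) (a : I -> J -> R) (x y : J -> M) i :
  lc a (fun j => x j + y j) i = lc a x i + lc a y i.
Proof.
by rewrite /lc -big_split; apply: eq_bigr => j _; rewrite scalerDr.
Qed.

Lemma lcZ (I J : finType) (a : I -> J -> R) (x : J -> M) c i :
  lc a (fun j => c *: x j) i = c *: lc a x i.
Proof.
by rewrite /lc scaler_sumr; apply: eq_bigr => j _; rewrite !scalerA mulrC.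
Qed.

Lemma lcZl (I J : finType) (a : I -> J -> R) (x : J -> M) c i :
  lc (fun i j => c * a i j) x i = c *: lc a x i.
Proof.
by rewrite /lc scaler_sumr; apply: eq_bigr => j _; rewrite !scalerA.
Qed.

Lemma lc_row (I J J' : finType) (a : I -> J -> R) (b : I -> J' -> R)
    (x : J -> M) (y : J' -> M) i :
  lc (blk_row a b) (blk_col x y) i = lc a x i + lc b y i.
Proof. by rewrite /lc big_sumType. Qed.

Definition delta (I : finType) : I -> I -> R := fun i j => (i == j)%:R.

Lemma lc1 (I : finType) (x : I -> M) i : lc (@delta I) x i = x i.
Proof.
rewrite /lc (bigD1 i) //= big1 ?addr0 /delta ?eqxx ?scale1r // => j /negPf ji.
by rewrite eq_sym ji scale0r.
Qed.

Lemma lc1tr (I : finType) (x : I -> M) i : lc (tr (@delta I)) x i = x i.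
Proof. by rewrite -[RHS]lc1; apply: eq_lc => // j k; rewrite /tr /delta eq_sym. Qed.

Lemma linear_lc (f : {linear M -> N}) (I J : finType) (a : I -> J -> R)
    (x : J -> M) i : f (lc a x i) = lc a (f \o x) i.
Proof.
by rewrite /lc linear_sum; apply: eq_bigr => j _; rewrite linearZ.
Qed.

Definition tsum (I : finType) (x : I -> M) (y : I -> N) : tensor M N :=
  \sum_i pure_tensor (x i) (y i).

Lemma pure0l (y : N) : pure_tensor (0 : M) y = 0.
Proof. by rewrite -(scale0r (0 : M)) pureZl scale0r. Qed.

Lemma pure0r (x : M) : pure_tensor x (0 : N) = 0.
Proof. by rewrite -(scale0r (0 : N)) pureZr scale0r. Qed.

Lemma pure_suml (I : finType) (x : I -> M) y :
  pure_tensor (\sum_i x i) y = \sum_i pure_tensor (x i) y :> tensor M N.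
Proof.
elim/big_rec2: _ => [|i t u _ <-]; first exact: pure0l.
exact: pureDl.
Qed.

Lemma pure_sumr (I : finType) x (y : I -> N) :
  pure_tensor x (\sum_i y i) = \sum_i pure_tensor x (y i) :> tensor M N.
Proof.
elim/big_rec2: _ => [|i t u _ <-]; first exact: pure0r.
exact: pureDr.
Qed.

(** Matrices move across the tensor sign by transposition: this turns a
    factorization [m = a m'] into the condition [a^T q = 0] on the other side. *)
Lemma tsum_lc (I J : finType) (a : I -> J -> R) (x : J -> M) (y : I -> N) :
  tsum (lc a x) y = tsum x (lc (tr a) y).
Proof.
rewrite /tsum /lc; under eq_bigr => i _ do rewrite pure_suml.
rewrite exchange_big; apply: eq_bigr => j _ /=; rewrite pure_sumr.
by apply: eq_bigr => i _; rewrite pureZl pureZr.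
Qed.

Lemma tsum0r (I : finType) (x : I -> M) (y : I -> N) :
  (forall i, y i = 0) -> tsum x y = 0.
Proof. by move=> y0; rewrite /tsum big1 // => i _; rewrite y0 pure0r. Qed.

Lemma tsum0l (I : finType) (x : I -> M) (y : I -> N) :
  (forall i, x i = 0) -> tsum x y = 0.
Proof. by move=> x0; rewrite /tsum big1 // => i _; rewrite x0 pure0l. Qed.

Lemma tsumDl (I : finType) (x x' : I -> M) (y : I -> N) :
  tsum (fun i => x i + x' i) y = tsum x y + tsum x' y.
Proof. by rewrite /tsum -big_split; apply: eq_bigr => i _; rewrite pureDl. Qed.

Lemma tsumZl (I : finType) c (x : I -> M) (y : I -> N) :
  tsum (fun i => c *: x i) y = c *: tsum x y.
Proof. by rewrite /tsum scaler_sumr; apply: eq_bigr => i _; rewrite pureZl. Qed.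

Lemma tsumZr (I : finType) c (x : I -> M) (y : I -> N) :
  tsum x (fun i => c *: y i) = c *: tsum x y.
Proof. by rewrite /tsum scaler_sumr; apply: eq_bigr => i _; rewrite pureZr. Qed.

Lemma tsum_blk (I J : finType) (x : I -> M) (x' : J -> M) y y' :
  tsum (blk_col x x') (blk_col y y') = tsum x y + tsum x' y' :> tensor M N.
Proof. by rewrite /tsum big_sumType. Qed.

Lemma eq_tsum (I : finType) (x x' : I -> M) (y y' : I -> N) :
  (forall i, x i = x' i) -> (forall i, y i = y' i) -> tsum x y = tsum x' y'.
Proof. by move=> xE yE; apply: eq_bigr => i _; rewrite xE yE. Qed.

Lemma tensor_tsum (t : tensor M N) :
  exists k (x : 'I_k -> M) (y : 'I_k -> N), t = tsum x y.
Proof.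
elim/tensor_ind: t => s; exists (size s).
exists (fun i => (tnth (in_tuple s) i).1), (fun i => (tnth (in_tuple s) i).2).
by rewrite tensor_piE /tsum big_tnth.
Qed.

End LinearCombinations.

Lemma tensor_map_tsum (R : comPzRingType) (M M' N N' : lmodType R)
    (f : {linear M -> M'}) (g : {linear N -> N'}) (I : finType) x y :
  tensor_map f g (tsum x y) = tsum (f \o x) (g \o y :> (I -> _)).
Proof.
by rewrite /tsum linear_sum; apply: eq_bigr => i _; apply: tensor_map_pure.
Qed.

(** * Vanishing in a tensor product *)

Section RelationSum.
Variables (R : comPzRingType) (M N : lmodType R).

(** A formal sum of pairs is viewed as an element of the direct sum of copies of
    [M] indexed by the elements of [N]. *)
Definition coeff_at (s : seq (M * N)) (n : N) : M := \sum_(p <- s | p.2 == n) p.1.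

(** The kernel of the direct sum of copies of [M] indexed by [N] onto the tensor
    product: sums of elements [m rho], with [rho] a linear relation between
    elements of [N], given as a list of coefficients and arguments. *)
Definition relation_sum (F : N -> M) : Prop :=
  exists r : seq (M * seq (R * N)),
    (forall x, x \in r -> \sum_(c <- x.2) c.1 *: c.2 = 0) /\
    forall n, F n = \sum_(x <- r) (\sum_(c <- x.2 | c.2 == n) c.1) *: x.1.

Lemma relation_sumD F G :
  relation_sum F -> relation_sum G -> relation_sum (fun n => F n + G n).
Proof.
move=> [r [r0 rF]] [s [s0 sG]]; exists (r ++ s); split=> [x|n].
  by rewrite mem_cat => /orP [/r0|/s0].
by rewrite big_cat /= rF sG.
Qed.

Lemma relation_sumN F : relation_sum F -> relation_sum (fun n => - F n).
Proof.
move=> [r [r0 rF]]; exists [seq (- x.1, x.2) | x <- r]; split=> [x|n].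
  by move=> /mapP [y /r0 y0 ->].
by rewrite rF big_map -sumrN; apply: eq_bigr => x _; rewrite scalerN.
Qed.

Lemma relation_sum0 F : (forall n, F n = 0) -> relation_sum F.
Proof. by move=> F0; exists [::]; split=> // n; rewrite big_nil F0. Qed.

Lemma relation_sum1 F (m : M) (s : seq (R * N)) :
    \sum_(c <- s) c.1 *: c.2 = 0 ->
    (forall n, F n = (\sum_(c <- s | c.2 == n) c.1) *: m) ->
  relation_sum F.
Proof.
move=> s0 FE; exists [:: (m, s)]; split=> [x|n].
  by rewrite inE => /eqP ->.
by rewrite big_seq1.
Qed.

Lemma eq_relation_sum F G : (forall n, F n = G n) -> relation_sum F -> relation_sum G.
Proof. by move=> FG [r [r0 rF]]; exists r; split=> // n; rewrite -FG. Qed.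

(** Since relation sums form a group and the coefficients are additive in the
    formal sum, the congruence rules and the commutation rule are automatic; only
    right additivity and scaling produce an actual relation between elements of
    [N]. *)
Lemma tensor_rel_relation_sum s t : tensor_rel s t ->
  relation_sum (fun n => coeff_at s n - coeff_at t n).
Proof.
have coeff_cat s1 s2 n : coeff_at (s1 ++ s2) n = coeff_at s1 n + coeff_at s2 n.
  by rewrite /coeff_at big_cat.
elim=> {s t} [s|s t _ st|s t u _ st _ tu|s s' t t' _ ss' _ tt'|s t|n|m m' n|m n n'|b m n].
- by apply: relation_sum0 => n; rewrite subrr.
- by apply: eq_relation_sum (relation_sumN st) => n; rewrite opprB.
- by apply: eq_relation_sum (relation_sumD st tu) => n; rewrite addrA subrK.
- apply: eq_relation_sum (relation_sumD ss' tt') => n.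
  by rewrite !coeff_cat opprD addrACA.
- by apply: relation_sum0 => n; rewrite !coeff_cat [X in X - _]addrC subrr.
- by apply: relation_sum0 => n'; rewrite /coeff_at big_cons !big_nil /= addr0 subr0 if_same.
- apply: relation_sum0 => n'; rewrite /coeff_at !big_cons !big_nil /=.
  by case: (n == n'); rewrite ?addr0 subrr.
- apply: (@relation_sum1 _ m [:: (1, n + n'); (-1, n); (-1, n')]).
    by rewrite !big_cons big_nil /= !scaleN1r scale1r addr0 -opprD subrr.
  move=> x; rewrite /coeff_at !big_cons !big_nil /=.
  by case: (n + n' == x); case: (n == x); case: (n' == x);
    rewrite ?addr0 ?scalerDl ?scaleN1r ?scale1r ?scale0r ?opprD ?oppr0 ?add0r ?addr0.
- apply: (@relation_sum1 _ m [:: (b, n); (-1, b *: n)]).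
    by rewrite !big_cons big_nil /= addr0 scaleN1r subrr.
  move=> x; rewrite /coeff_at !big_cons !big_nil /=.
  by case: (n == x); case: (b *: n == x);
    rewrite ?addr0 ?scalerDl ?scaleN1r ?scale0r ?oppr0 ?add0r ?addr0.
Qed.

End RelationSum.

Lemma partition_sum (R : comPzRingType) (V : lmodType R) (T : choiceType)
    (U : seq T) (s : seq (R * T)) (h : T -> V) :
  {subset [seq c.2 | c <- s] <= U} ->
  \sum_(c <- s) c.1 *: h c.2 =
  \sum_(t : seq_sub U) (\sum_(c <- s | c.2 == val t) c.1) *: h (val t).
Proof.
elim: s => [|c s IHs] sU.
  by rewrite big_nil big1 // => t _; rewrite big_nil scale0r.
rewrite big_cons IHs; last by move=> x xs; apply: sU; rewrite inE xs orbT.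
have cU : c.2 \in U by apply: sU; rewrite inE eqxx.
rewrite (bigD1 (SeqSub cU)) //= [in RHS](bigD1 (SeqSub cU)) //= big_cons eqxx.
rewrite scalerDl -!addrA; congr (_ + (_ + _)).
apply: eq_bigr => t /negPf tc; rewrite big_cons eq_sym.
by rewrite -[c.2]/(val (SeqSub cU)) val_eqE tc.
Qed.

Section TensorVanishing.
Variables (R : comPzRingType) (M N : lmodType R).

(** The auxiliary tuple [q'], which is paired with zero, is there because the
    [q i] need not generate [N]. *)
Lemma tsum_eq0 (I : finType) (m : I -> M) (q : I -> N) : tsum m q = 0 ->
  exists (I' J : finType) (q' : I' -> N) (a : I -> J -> R) (a' : I' -> J -> R)
         (m' : J -> M),
  [/\ forall i, m i = lc a m' i, forall i, lc a' m' i = 0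
    & forall j, lc (tr a) q j + lc (tr a') q' j = 0].
Proof.
set s := [seq (m i, q i) | i <- index_enum I] => mq0.
have : tensor_rel s [::].
  apply/tensor_piP; rewrite !tensor_piE big_nil big_map /=.
  exact: mq0.
move=> /tensor_rel_relation_sum [r [r0 rE]].
(* The rows of the second block are all the elements of [N] that occur.  The
   columns indexed by [I] say that [q i] equals itself as a listed element of
   [N], which separates indices with the same value of [q]. *)
pose U := [seq q i | i <- enum I] ++ flatten [seq [seq c.2 | c <- x.2] | x <- r].
pose J := (I + 'I_(size r))%type.
pose rr (k : 'I_(size r)) := tnth (in_tuple r) k.
pose rho (k : 'I_(size r)) (n : N) := \sum_(c <- (rr k).2 | c.2 == n) c.1.
exists (seq_sub U), J, val.
exists (blk_row (@delta R I) (fun _ _ => 0)).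
exists (blk_row (fun n i => - (q i == val n)%:R) (fun n k => rho k (val n))).
exists (blk_col m (fun k => (rr k).1)).
split=> [i|n|[i|k]].
- by rewrite lc_row lc1 [X in _ + X]/lc big1 ?addr0 // => j _; rewrite scale0r.
- rewrite lc_row {2}/lc.
  have -> : \sum_j rho j (val n) *: (rr j).1 = coeff_at s (val n).
    move: (rE (val n)); rewrite /coeff_at big_nil subr0 => ->.
    by rewrite [RHS]big_tnth.
  rewrite /coeff_at big_map /= [X in _ + X]big_mkcond /= /lc -big_split /=.
  apply: big1 => i _; case: (q i == val n); first by rewrite scaleN1r addNr.
  by rewrite oppr0 scale0r addr0.
- rewrite [X in X + _](_ : _ = q i); last first.
    by rewrite -[RHS]lc1tr; apply: eq_bigr.
  have qU : q i \in U by rewrite mem_cat map_f ?mem_enum.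
  rewrite /lc (bigD1 (SeqSub qU)) //= /tr /= eqxx scaleN1r big1 ?addr0 ?subrr //.
  move=> n /negPf nq; rewrite eq_sym -[q i]/(val (SeqSub qU)) val_eqE nq.
  by rewrite oppr0 scale0r.
- rewrite [X in X + _]/lc big1 ?add0r => [|i _]; last by rewrite scale0r.
  have rk : rr k \in r by rewrite /rr mem_tnth.
  rewrite -[RHS](r0 _ rk) -[RHS]/(\sum_(c <- (rr k).2) c.1 *: id c.2).
  rewrite (partition_sum (U := U)) // => x xr.
  rewrite mem_cat; apply/orP; right; apply/flattenP.
  by exists [seq c.2 | c <- (rr k).2] => //; apply/mapP; exists (rr k).
Qed.

End TensorVanishing.

(** * Equational flatness *)

Section Span.
Variables (R : comPzRingType) (N : lmodType R) (I : finType) (q : I -> N).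

Definition in_span : pred N := fun x => `[< exists c : I -> R, x = \sum_i c i *: q i >].

Fact in_span_submod : submod_closed in_span.
Proof.
split; first by apply/asboolP; exists (fun=> 0); rewrite big1 // => i _; rewrite scale0r.
move=> a x y /asboolP [c ->] /asboolP [d ->]; apply/asboolP.
exists (fun i => a * c i + d i); rewrite scaler_sumr -big_split.
by apply: eq_bigr => i _; rewrite scalerDl scalerA.
Qed.

HB.instance Definition _ := GRing.isSubmodClosed.Build R N in_span in_span_submod.

Definition span_mod := {x | in_span x}.
HB.instance Definition _ := SubChoice.on span_mod.
HB.instance Definition _ := [SubChoice_isSubLmodule of span_mod by <:].

End Span.

Section Flat.
Variable R : comPzRingType.

(** A reason for [tsum m q = 0] that can be checked on the two factors
    separately. *)
Definition eq_vanish (M N : lmodType R) (I : finType) (m : I -> M) (q : I -> N) :=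
  exists (J : finType) (a : I -> J -> R) (m' : J -> M),
    (forall i, m i = lc a m' i) /\ forall j, lc (tr a) q j = 0.

Lemma eq_vanish_tsum (M N : lmodType R) (I : finType) (m : I -> M) (q : I -> N) :
  eq_vanish m q -> tsum m q = 0.
Proof.
move=> [J [a [m' [mE q0]]]].
by rewrite (eq_tsum mE (fun=> erefl)) tsum_lc tsum0r.
Qed.

(** Flatness allows to replace [N] by the span of the [q i].  There the auxiliary
    tuple of the general criterion is expressed through [q] and can be folded
    into the matrix. *)
Lemma flat_vanish (M N : lmodType R) (I : finType) (m : I -> M) (q : I -> N) :
  flat M -> tsum m q = 0 -> eq_vanish m q.
Proof.
move=> flatM mq0.
have qL i : in_span q (q i).
  apply/asboolP; exists (delta _ i); exact/esym/lc1.
pose qq i : span_mod q := exist _ (q i) (qL i).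
have mqq0 : tsum m qq = 0.
  apply: (flatM _ _ (val : {linear span_mod q -> N}) val_inj).
  by rewrite tensor_map_tsum linear0 -mq0.
have [I' [J [q' [a [a' [m' [mE m'0 aq0]]]]]]] := tsum_eq0 mqq0.
have /choice [C CE] : forall i', exists c : I -> R, val (q' i') = \sum_i c i *: q i.
  by move=> i'; apply/asboolP; exact: valP (q' i').
exists J, (fun i j => a i j + cmul (tr C) a' i j), m'; split=> [i|j].
  rewrite mE /lc; under [RHS]eq_bigr => j _ do rewrite scalerDl.
  rewrite big_split /= -/(lc a m' i) -/(lc (cmul (tr C) a') m' i) -lcA.
  by rewrite [X in _ + X]lc0 ?addr0.
have := congr1 val (aq0 j); rewrite linear0 linearD !linear_lc => aq0'.
rewrite -[RHS]aq0' /lc /tr; under eq_bigr => i _ do rewrite scalerDl.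
rewrite big_split; congr (_ + _) => /=.
under [RHS]eq_bigr => i' _ do rewrite CE scaler_sumr.
rewrite exchange_big; apply: eq_bigr => i _ /=; rewrite scaler_suml.
by apply: eq_bigr => i' _; rewrite scalerA mulrC.
Qed.

(** Relations are taken in whole systems, since this is the form in which they
    are used and it spares an induction on the number of equations. *)
Definition eqflat (M : lmodType R) : Prop :=
  forall (I K : finType) (alpha : K -> I -> R) (m : I -> M),
    (forall k, lc alpha m k = 0) ->
  exists (J : finType) (a : I -> J -> R) (m' : J -> M),
    (forall i, m i = lc a m' i) /\ forall k j, cmul alpha a k j = 0.

(** The system is one vanishing tensor in [M (x) R^K], whose second entries are
    the columns of [alpha]. *)
Lemma flat_eqflat (M : lmodType R) : flat M -> eqflat M.
Proof.
move=> flatM I K alpha m am0.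
pose P := module_prod (fun _ : K => R^o).
pose q (i : I) : P := fun k => alpha k i.
have [J [a [m' [mE q0]]]] : eq_vanish m q.
  apply: flat_vanish => //.
  pose e (k : K) : P := fun k' => (k == k')%:R.
  rewrite -(tsum0l e am0) tsum_lc; apply: eq_tsum => // i.
  apply: functional_extensionality_dep => k.
  rewrite -[RHS]/(module_proj k (lc _ e i)) linear_lc.
  rewrite [RHS]/lc (bigD1 k) //= big1 ?addr0 /e.
    by rewrite /module_proj eqxx; exact/esym/mulr1.
  by move=> k' /negPf k'k; rewrite /module_proj k'k; exact: mulr0.
exists J, a, m'; split=> // k j.
have := congr1 (module_proj k) (q0 j); rewrite linear0 linear_lc => kj.
by rewrite -[RHS]kj; apply: eq_bigr => i _; exact: mulrC.
Qed.

(** In the general vanishing criterion the auxiliary tuple of [M] is zero, that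
    is, it satisfies a system of relations; solving this system removes the
    auxiliary tuple of [N'], and what remains lies in the image of [N]. *)
Lemma eqflat_flat (M : lmodType R) : eqflat M -> flat M.
Proof.
move=> flatM N N' f f_inj.
suff inj0 x : tensor_map (idfun : {linear M -> M}) f x = 0 -> x = 0.
  by move=> x y xy; apply/subr0_eq/inj0; rewrite linearB; apply/eqP; rewrite subr_eq0; apply/eqP.
have [k [m [n ->]]] := tensor_tsum x.
rewrite tensor_map_tsum => /tsum_eq0 [I' [J [q' [a [a' [m' [mE m'0 aq0]]]]]]].
have [J' [b [m'' [m'E b0]]]] := flatM _ _ _ _ m'0.
apply: eq_vanish_tsum; exists J', (cmul a b), m''; split=> [i|j].
  by rewrite -lcA [LHS]mE; apply: eq_lc.
apply: f_inj; rewrite linear0 linear_lc lc_tr_cmul.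
rewrite (eq_lc (b := tr b) (y := fun j => - lc (tr a') q' j)) //; last first.
  by move=> j'; apply/eqP; rewrite -addr_eq0 aq0.
rewrite -[RHS]oppr0 /lc; under eq_bigr => j' _ do rewrite scalerN.
rewrite sumrN; congr (- _); rewrite -/(lc (tr b) (lc (tr a') q') j) -lc_tr_cmul.
by rewrite /lc big1 // => i _; rewrite /tr b0 scale0r.
Qed.

(** * Mittag-Leffler, equationally *)

Definition ml_witness (Q : lmodType R -> Prop) (M : lmodType R) (I J : finType)
    (m : I -> M) (a : I -> J -> R) : Prop :=
  forall (D : lmodType R) (q : I -> D), Q D -> eq_vanish m q ->
    forall j, lc (tr a) q j = 0.

Definition eq_ml (Q : lmodType R -> Prop) (M : lmodType R) : Prop :=
  forall (I : finType) (m : I -> M),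
    exists (J : finType) (a : I -> J -> R) (m' : J -> M),
    (forall i, m i = lc a m' i) /\ ml_witness Q m a.

Lemma lc_enum (M : lmodType R) (I J : finType) (a : I -> J -> R) (x : J -> M) i :
  lc a x i = lc (fun i (k : 'I_#|J|) => a i (enum_val k)) (x \o enum_val) i.
Proof. by rewrite /lc (reindex _ (onW_bij _ (enum_val_bij J))). Qed.

(** If every factorization of [m] fails for some [q], collect these [q] into one
    tuple in the product indexed by all factorizations.  Its tensor with [m]
    vanishes by the Mittag-Leffler property, and flatness provides a single
    factorization that works for all components, including its own. *)
Lemma mittag_leffler_eq_ml (Q : lmodType R -> Prop) (M : lmodType R) :
  flat M -> mittag_leffler Q M -> eq_ml Q M.
Proof.
move=> flatM mlM I m; apply: contrapT => noF.
(* The index type must be as small as the modules, hence matrices with columns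
   in an ordinal and a mere existence statement about the other factor. *)
pose T := {l : {k : nat & I -> 'I_k -> R} |
           exists m' : 'I_(projT1 l) -> M, forall i, m i = lc (projT2 l) m' i}.
have /choice [D DP] : forall l : T, exists D : {D : lmodType R & I -> D},
    [/\ Q (projT1 D), eq_vanish m (projT2 D)
      & ~ forall j, lc (tr (projT2 (sval l))) (projT2 D) j = 0].
  move=> [[k a] [m' mE]] /=; apply: contrapT => noD; apply: noF.
  exists 'I_k, a, m'; split=> // D q QD mq j; apply: contrapT => nq.
  by apply: noD; exists (existT _ D q); split=> // /(_ j).
pose q (i : I) : module_prod (fun l => projT1 (D l)) := fun l => projT2 (D l) i.
have mq0 : tsum m q = 0.
  apply: (mlM _ _ (fun l => (let: And3 x _ _ := DP l in x))).
  apply: functional_extensionality_dep => l; rewrite /tensor_prod_map linear0.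
  rewrite tensor_map_tsum; apply: eq_vanish_tsum.
  by have [_ ? _] := DP l.
have [J [a [m' [mE q0]]]] := flat_vanish flatM mq0.
have m'E : exists m'' : 'I_#|J| -> M, forall i,
    m i = lc (fun i (k : 'I_#|J|) => a i (enum_val k)) m'' i.
  by exists (m' \o enum_val) => i; rewrite -lc_enum.
pose l : T := exist _ (existT (fun k : nat => I -> 'I_k -> R) #|J| _) m'E.
have [_ _] := DP l; apply=> j /=.
rewrite -[RHS](congr1 (module_proj l) (q0 (enum_val j))) linear_lc.
exact: eq_bigr.
Qed.

Lemma eq_ml_mittag_leffler (Q : lmodType R -> Prop) (M : lmodType R) :
  flat M -> eq_ml Q M -> mittag_leffler Q M.
Proof.
move=> flatM mlM I F QF x y xy; apply/subr0_eq.
have [k [m [q xyE]]] := tensor_tsum (x - y); rewrite xyE.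
have [J [a [m' [mE mla]]]] := mlM _ m.
apply: eq_vanish_tsum; exists J, a, m'; split=> // j.
apply: functional_extensionality_dep => i.
rewrite -[LHS]/(module_proj i _) linear_lc.
apply: mla => //; apply: flat_vanish => //.
rewrite -[LHS](tensor_map_tsum idfun (module_proj (Q := F) i)) -xyE linearB.
by apply/eqP; rewrite subr_eq0; apply/eqP; exact: (congr1 (fun g => g i) xy).
Qed.

End Flat.

(** * Free modules *)

Section Free.
Variables (R : comPzRingType) (T : choiceType).

(** The free module is a quotient of the lists of coefficients and generators by
    equality of all evaluations: its universal property then holds by
    construction, and finitely supported functions are avoided. *)
Definition feval (N : lmodType R) (h : T -> N) (s : seq (R * T)) : N :=
  \sum_(c <- s) c.1 *: h c.2.

Definition free_eqb : rel (seq (R * T)) := fun s t =>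
  `[< forall (N : lmodType R) (h : T -> N), feval h s = feval h t >].

Lemma free_eqb_equiv : equiv_class_of free_eqb.
Proof.
split=> [s|s t|t s u]; first exact/asboolP.
- by apply/asboolP/asboolP => H N h; rewrite H.
- by move=> /asboolP st /asboolP tu; apply/asboolP => N h; rewrite st tu.
Qed.

Definition free_equiv : equiv_rel (seq (R * T)) := EquivRelPack free_eqb_equiv.

Definition free_mod : Type := {eq_quot free_equiv}.
HB.instance Definition _ := Choice.on free_mod.
HB.instance Definition _ := EqQuotient.on free_mod.

Definition free_lift (N : lmodType R) (h : T -> N) (x : free_mod) : N := feval h (repr x).

Lemma free_piP s t :
  (forall (N : lmodType R) (h : T -> N), feval h s = feval h t) <->
  \pi_(free_mod) s = \pi_(free_mod) t.
Proof.
split=> [st|/eqquotP /asboolP //].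
by apply/eqquotP/asboolP.
Qed.

Lemma free_lift_pi (N : lmodType R) (h : T -> N) s : free_lift h (\pi_(free_mod) s) = feval h s.
Proof. by apply: (free_piP _ _).2; rewrite reprK. Qed.

Lemma free_lift_ext (x y : free_mod) :
  (forall (N : lmodType R) (h : T -> N), free_lift h x = free_lift h y) -> x = y.
Proof. by move=> xy; rewrite -[x]reprK -[y]reprK; apply: (free_piP _ _).1. Qed.

Definition free_zero : free_mod := \pi_(free_mod) [::].
Definition free_add (x y : free_mod) : free_mod := \pi_(free_mod) (repr x ++ repr y).
Definition free_scale (a : R) (x : free_mod) : free_mod :=
  \pi_(free_mod) [seq (a * c.1, c.2) | c <- repr x].
Definition free_opp : free_mod -> free_mod := free_scale (-1).

Lemma free_lift0 (N : lmodType R) (h : T -> N) : free_lift h free_zero = 0.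
Proof. by rewrite free_lift_pi /feval big_nil. Qed.

Lemma free_liftD (N : lmodType R) (h : T -> N) x y :
  free_lift h (free_add x y) = free_lift h x + free_lift h y.
Proof. by rewrite free_lift_pi /feval big_cat. Qed.

Lemma free_liftZ (N : lmodType R) (h : T -> N) a x :
  free_lift h (free_scale a x) = a *: free_lift h x.
Proof.
rewrite free_lift_pi /feval big_map /= /free_lift scaler_sumr.
by apply: eq_bigr => c _; rewrite scalerA.
Qed.

Fact free_addA : associative free_add.
Proof. by move=> x y z; apply: free_lift_ext => N h; rewrite !free_liftD addrA. Qed.
Fact free_addC : commutative free_add.
Proof. by move=> x y; apply: free_lift_ext => N h; rewrite !free_liftD addrC. Qed.
Fact free_add0 : left_id free_zero free_add.
Proof. by move=> x; apply: free_lift_ext => N h; rewrite !free_liftD free_lift0 add0r. Qed.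
Fact free_addN : left_inverse free_zero free_opp free_add.
Proof.
move=> x; apply: free_lift_ext => N h.
by rewrite !free_liftD free_liftZ free_lift0 scaleN1r addNr.
Qed.
HB.instance Definition _ := GRing.isZmodule.Build free_mod
  free_addA free_addC free_add0 free_addN.

Fact free_scaleA a b x : free_scale a (free_scale b x) = free_scale (a * b) x.
Proof. by apply: free_lift_ext => N h; rewrite !free_liftZ scalerA. Qed.
Fact free_scale1 : left_id 1 free_scale.
Proof. by move=> x; apply: free_lift_ext => N h; rewrite free_liftZ scale1r. Qed.
Fact free_scaleDr : right_distributive free_scale +%R.
Proof.
move=> a x y; apply: free_lift_ext => N h.
by rewrite free_liftZ !free_liftD !free_liftZ scalerDr.
Qed.
Fact free_scaleDl x : {morph free_scale^~ x : a b / a + b}.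
Proof.
move=> a b; apply: free_lift_ext => N h.
by rewrite free_liftZ !free_liftD !free_liftZ scalerDl.
Qed.
HB.instance Definition _ := GRing.Zmodule_isLmodule.Build R free_mod
  free_scaleA free_scale1 free_scaleDr free_scaleDl.

Lemma free_lift_linear (N : lmodType R) (h : T -> N) : linear (free_lift h).
Proof. by move=> a x y; rewrite free_liftD free_liftZ. Qed.
HB.instance Definition _ (N : lmodType R) (h : T -> N) :=
  GRing.isLinear.Build R free_mod N _ (free_lift h) (free_lift_linear h).

Definition free_gen (t : T) : free_mod := \pi_(free_mod) [:: (1, t)].

Lemma free_lift_gen (N : lmodType R) (h : T -> N) t : free_lift h (free_gen t) = h t.
Proof. by rewrite free_lift_pi /feval big_seq1 scale1r. Qed.

Lemma free_piE s : \pi_(free_mod) s = \sum_(c <- s) c.1 *: free_gen c.2.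
Proof.
apply: free_lift_ext => N h; rewrite free_lift_pi linear_sum.
apply: eq_bigr => c _; rewrite linearZ; congr (_ *: _).
exact/esym/free_lift_gen.
Qed.

Lemma free_ext (N : lmodType R) (f g : {linear free_mod -> N}) :
  (forall t, f (free_gen t) = g (free_gen t)) -> forall x, f x = g x.
Proof.
move=> fg x; rewrite -[x]reprK free_piE !linear_sum.
by apply: eq_bigr => c _; rewrite !linearZ fg.
Qed.

Lemma free_projective : projective free_mod.
Proof.
move=> N N' g f g_surj.
have /choice [h hE] : forall t, exists n, g n = f (free_gen t).
  by move=> t; apply: g_surj.
exists (free_lift h : {linear free_mod -> N}) => x.
rewrite -[LHS]/((g \o free_lift h : {linear free_mod -> N'}) x).
by apply: free_ext => t /=; rewrite free_lift_gen hE.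
Qed.

(** Coefficients are evaluations at indicator functions, so a relation between
    elements of a free module is a relation between their coefficients. *)
Lemma free_eqflat : eqflat free_mod.
Proof.
move=> I K alpha m am0.
pose U := flatten [seq [seq c.2 | c <- repr (m i)] | i <- enum I].
pose co (t : T) : {linear free_mod -> R^o} := free_lift (fun t' => (t' == t)%:R : R^o).
have coE t i : co t (m i) = \sum_(c <- repr (m i) | c.2 == t) c.1.
  rewrite big_mkcond /= -[LHS]/(\sum_(c <- repr (m i)) c.1 *: ((c.2 == t)%:R : R^o)).
  apply: eq_bigr => c _; case: (c.2 == t); last exact: mulr0.
  exact: mulr1.
exists (seq_sub U), (fun i t => co (val t) (m i)), (fun t => free_gen (val t)).
split=> [i|k t].
  rewrite -[LHS]reprK free_piE (partition_sum (U := U)).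
    by apply: eq_bigr => t _; rewrite coE.
  move=> t ti; apply/flattenP; exists [seq c.2 | c <- repr (m i)] => //.
  by apply/mapP; exists i => //; rewrite mem_enum.
by rewrite -[RHS](linear0 (co (val t))) -(am0 k) linear_lc.
Qed.

End Free.

Section Projective.
Variables (R : comPzRingType).

Lemma projective_eqflat (P : lmodType R) : projective P -> eqflat P.
Proof.
move=> projP I K alpha m am0.
pose p : {linear free_mod R P -> P} := free_lift (id : P -> P).
have p_surj y : exists x, p x = y by exists (free_gen R y); exact: free_lift_gen.
have [s sE] := projP _ _ p (idfun : {linear P -> P}) p_surj.
have [k|J [a [m' [mE a0]]]] := @free_eqflat R P I K alpha (s \o m).
  by rewrite -linear_lc am0 linear0.
exists J, a, (p \o m'); split=> // i.
by rewrite -linear_lc -mE; exact/esym/sE.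
Qed.

(** A module with its map to the next term of a complex: the state that is
    iterated to build a free resolution. *)
Record arrow := Arrow {
  arr_src : lmodType R; arr_tgt : lmodType R; arr_fun : {linear arr_src -> arr_tgt} }.

Definition arr_ker (f : arrow) : choiceType := {x : arr_src f | arr_fun f x == 0}.

Definition arr_next (f : arrow) : arrow :=
  Arrow (free_lift (val : arr_ker f -> arr_src f) : {linear free_mod R (arr_ker f) -> arr_src f}).

Lemma arr_next_exact (f : arrow) : exact_at (arr_fun (arr_next f)) (arr_fun f).
Proof.
move=> y; split=> [fy0|[x <-]].
  have fy : arr_fun f y == 0 by apply/eqP.
  by exists (free_gen R (exist _ y fy : arr_ker f)); exact: free_lift_gen.
rewrite -[LHS]/((arr_fun f \o arr_fun (arr_next f)) x) -[RHS]/((\0 : {linear _ -> _}) x).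
apply: free_ext => t /=; rewrite free_lift_gen.
by apply/eqP; apply: valP t.
Qed.

Variable B : lmodType R.

Definition free_stage (n : nat) : arrow :=
  iter n arr_next (Arrow (free_lift (id : B -> B) : {linear free_mod R B -> B})).

Lemma free_stage_proj n : projective (arr_src (free_stage n)).
Proof. by case: n => [|n]; apply: free_projective. Qed.

Fact free_stage_surj (m : B) : exists x, arr_fun (free_stage 0) x = m.
Proof. by exists (free_gen R m); exact: free_lift_gen. Qed.

Definition free_resolution : resolution B :=
  @Resolution R B (fun i => arr_src (free_stage i)) (fun i => arr_fun (free_stage i.+1))
    (arr_fun (free_stage 0)) free_stage_surj
    (@arr_next_exact (free_stage 0)) (fun i => @arr_next_exact (free_stage i.+1)).

End Projective.

(** * Tor, elementwise *)

Section Tor.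
Variables (R : comPzRingType) (B D : lmodType R).

(** The vanishing of the class of [(a, b, d)] in [Tor_1(B, D)].  To lift [b]
    through a flat module [P] onto [B] gives [a y] in the kernel [K] of [P -> B],
    and the class is the tensor of [a y] and [d] in [K (x) D], which dies in
    [P (x) D].  The equations say that this tensor is already zero in [K (x) D];
    the elements of [K] that are involved are [gamma] applied to a lift of [c]. *)
Definition tor_null (I K : finType) (a : I -> K -> R) (b : K -> B) (d : I -> D) :=
  exists (I' G V : finType) (d' : I' -> D) (beta : K -> V -> R) (gamma : G -> V -> R)
         (c : V -> B) (e : I -> G -> R) (e' : I' -> G -> R),
  [/\ forall k, b k = lc beta c k, forall g, lc gamma c g = 0,
      forall i v, cmul a beta i v = cmul e gamma i v,
      forall i v, cmul e' gamma i v = 0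
    & forall g, lc (tr e) d g + lc (tr e') d' g = 0].

Definition tor_trivial : Prop :=
  forall (I K : finType) (a : I -> K -> R) (b : K -> B) (d : I -> D),
    (forall i, lc a b i = 0) -> (forall k, lc (tr a) d k = 0) -> tor_null a b d.

(** Lift [c] to a tuple [nu] of the degree zero term: then [gamma nu] is the
    boundary of a tuple [ka], and [y - beta nu] is the boundary of a tuple [w].  Up to
    boundaries [x] is then [e ka + a w], where the second term dies against [d]
    and the first one is traded for [- e' ka], itself a boundary, against
    [d']. *)
Lemma tor_null_boundary (P : resolution B) (I K : finType) (a : I -> K -> R)
    (x : I -> P 1%N) (y : K -> P 0%N) (d : I -> D) :
    (forall i, res_d P 0 (x i) = lc a y i) -> (forall k, lc (tr a) d k = 0) ->
    tor_null a (res_aug P \o y) d ->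
  exists t, tensor_map (res_d P 1) (idfun : {linear D -> D}) t = tsum x d.
Proof.
move=> xE ad0 [I' [G [V [d' [be [ga [c [e [e' [yE gc0 abE ega0 ed0]]]]]]]]]].
have /choice [nu nuE] : forall v, exists n, res_aug P n = c v.
  by move=> v; exact: res_aug_surj.
have /choice [w wE] : forall k, exists w, res_d P 0 w = y k - lc be nu k.
  move=> k; apply/res_exact0; rewrite linearB linear_lc.
  by rewrite [X in X - _]yE (eq_lcr _ (y := c)) ?subrr.
have /choice [ka kaE] : forall g, exists w, res_d P 0 w = lc ga nu g.
  move=> g; apply/res_exact0; rewrite linear_lc.
  by rewrite (eq_lcr _ (y := c)).
have /choice [z zE] : forall i, exists z, res_d P 1 z = x i - lc e ka i - lc a w i.
  move=> i; apply/res_exactS.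
  have De : res_d P 0 (lc e ka i) = lc (cmul e ga) nu i.
    by rewrite linear_lc (eq_lcr _ (y := lc ga nu)) ?lcA.
  have Dw : res_d P 0 (lc a w i) = lc a y i - lc (cmul a be) nu i.
    rewrite linear_lc (eq_lcr _ (y := fun k => y k + -1 *: lc be nu k)).
      by rewrite lcD lcZ scaleN1r lcA.
    by move=> k; rewrite /= wE scaleN1r.
  rewrite !linearB /= De Dw xE opprB addrC addrA subrK.
  by apply/eqP; rewrite subr_eq0; apply/eqP/eq_lc.
have /choice [z' z'E] : forall i, exists z, res_d P 1 z = lc e' ka i.
  move=> i; apply/res_exactS; rewrite linear_lc (eq_lcr e' (y := lc ga nu)) //.
  by rewrite lcA /lc big1 // => v _; rewrite ega0 scale0r.
exists (tsum z d - tsum z' d'); rewrite linearB.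
rewrite -[LHS]/(tensor_map (res_d P 1) idfun (tsum z d)
                - tensor_map (res_d P 1) idfun (tsum z' d')).
rewrite !tensor_map_tsum.
have -> : tsum x d = tsum (fun i => res_d P 1 (z i)) d + (tsum (lc e ka) d + tsum (lc a w) d).
  rewrite -!tsumDl; apply: eq_tsum => // i.
  by rewrite zE -[_ - _ - _]addrA -opprD subrK.
congr (_ + _); rewrite [tsum (lc a w) d]tsum_lc [tsum w _]tsum0r // addr0.
rewrite (@eq_tsum _ _ _ _ (res_d P 1 \o z') (lc e' ka) _ d') //.
rewrite !tsum_lc; apply/eqP; rewrite eq_sym -addr_eq0; apply/eqP.
rewrite /tsum -big_split big1 // => g _ /=.
by rewrite -pureDr ed0 pure0r.
Qed.

Lemma tensor_res_d0 (P : resolution B) u :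
  tensor_map (res_d P 0) (idfun : {linear D -> D})
    (tensor_map (res_d P 1) (idfun : {linear D -> D}) u) = 0.
Proof.
have [k [x [d ->]]] := tensor_tsum u.
rewrite !tensor_map_tsum tsum0l // => i /=.
by apply/res_exactS; exists (x i).
Qed.

Lemma tor_trivial_Tor1 : tor_trivial -> Tor1_eq0 B D.
Proof.
move=> tor0 P projP t; split=> [|[u <-]]; last exact: tensor_res_d0.
have [k [x [d ->]]] := tensor_tsum t.
rewrite tensor_map_tsum => xd0.
have [K [a [y [xE ad0]]]] := flat_vanish (eqflat_flat (projective_eqflat (projP 0%N))) xd0.
apply: (tor_null_boundary (a := a) (y := y)) => //.
apply: tor0 => // i; rewrite -linear_lc -xE.
by apply/res_exact0; exists (x i).
Qed.

(** Use one free resolution.  Lift [b] to [y] and [a y] to [x] in degree one; the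
    tensor of [x] and [d] is a cycle, hence a boundary.  This is a vanishing
    tensor in degree one, and flatness turns it into a system of relations in
    degree zero, which flatness solves again. *)
Lemma Tor1_tor_trivial : Tor1_eq0 B D -> tor_trivial.
Proof.
move=> tor0 I K a b d ab0 ad0.
pose P := free_resolution B.
have projP i : projective (P i) by exact: free_stage_proj.
have /choice [y yE] : forall k, exists y, res_aug P y = b k.
  by move=> k; exact: res_aug_surj.
have /choice [x xE] : forall i, exists x, res_d P 0 x = lc a y i.
  by move=> i; apply/res_exact0; rewrite linear_lc (eq_lcr _ (y := b)).
have [|t] := (tor0 P projP (tsum x d)).1.
  rewrite tensor_map_tsum (@eq_tsum _ _ _ _ _ (lc a y) _ d) //.
  by rewrite tsum_lc tsum0r.
have [n [z [d' ->]]] := tensor_tsum t; rewrite tensor_map_tsum => zx.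
have : tsum (blk_col x (fun i => - res_d P 1 (z i))) (blk_col d d') = 0.
  rewrite tsum_blk -zx /tsum -big_split big1 // => i _ /=.
  by rewrite -pureDl subrr pure0l.
move=> /(flat_vanish (eqflat_flat (projective_eqflat (projP 1%N)))) [G [ee [ka [xeE ed0]]]].
pose e i := ee (inl i); pose e' i := ee (inr i).
pose dka g := res_d P 0 (ka g).
have Ee i : lc a y i = lc e dka i.
  by rewrite -xE [x i](xeE (inl i)) linear_lc.
have Ee' i : lc e' dka i = 0.
  rewrite -[lc _ _ _](@linear_lc _ _ _ (res_d P 0) _ _ e' ka i) -[lc e' ka i](xeE (inr i)) /=.
  have dd0 : res_d P 0 (res_d P 1 (z i)) = 0 by apply/res_exactS; exists (z i).
  by rewrite linearN /= dd0 oppr0.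
have [s|V [bg [nu [bgE rel0]]]] :=
    @projective_eqflat _ _ (projP 0%N) _ _
      (blk_col (blk_row a (fun i g => - e i g)) (blk_row (fun _ _ => 0) e'))
      (blk_col y dka).
  case: s => i; rewrite /blk_col -/(blk_col y dka).
    rewrite [lc _ _ _](@lc_row _ _ unit _ _ (fun=> a i) (fun _ g => - e i g) y dka tt).
    rewrite -[X in X + _]/(lc a y i) Ee -[X in _ + X]/(lc (fun i g => - e i g) dka i).
    by apply/eqP; rewrite addr_eq0 -sumrN; apply/eqP/eq_bigr => g _; rewrite scaleNr opprK.
  rewrite [lc _ _ _](@lc_row _ _ unit _ _ (fun=> fun=> 0) (fun _ => e' i) y dka tt).
  by rewrite [X in X + _]big1 ?add0r => [|k _]; rewrite ?scale0r //; exact: Ee'.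
exists 'I_n, G, V, d', (fun k => bg (inl k)), (fun g => bg (inr g)), (res_aug P \o nu), e, e'.
split=> [k|g|i v|i v|g].
- by rewrite -yE [y k](bgE (inl k)) linear_lc.
- rewrite -linear_lc -[X in res_aug P X](bgE (inr g)).
  by apply/res_exact0; exists (ka g).
- have := rel0 (inl i) v; rewrite /cmul big_sumType /= => /eqP.
  rewrite addr_eq0 -sumrN => /eqP ->; apply: eq_bigr => g _.
  by rewrite mulNr opprK.
- have := rel0 (inr i) v; rewrite /cmul big_sumType /= big1 ?add0r // => k _.
  by rewrite mul0r.
- by rewrite -[RHS](ed0 g) /lc [RHS]big_sumType.
Qed.

End Tor.

Lemma eqflat_regular (A : comPzRingType) : eqflat (A^o : lmodType A).
Proof.
move=> I K al m am0; exists unit, (fun i _ => m i), (fun=> 1); split=> [i|k j].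
  rewrite /lc (big_pred1 tt); first exact/esym/mulr1.
  by case.
exact: am0.
Qed.

(** * Restriction of scalars and base change *)

(** The ring map is a parameter of this type, which equals [V], so that it can be
    recovered when the [A]-module structure is inferred. *)
Definition restr (A B : comPzRingType) (phi : {rmorphism A -> B})
  (V : lmodType B) : Type := V.

Section Restriction.
Variables (A B : comPzRingType) (phi : {rmorphism A -> B}).



Section Instances.
Variable V : lmodType B.
HB.instance Definition _ := GRing.Zmodule.on (restr phi V).
Let rscale (a : A) (v : restr phi V) : restr phi V := phi a *: (v : V).
Fact restr_scaleA a b v : rscale a (rscale b v) = rscale (a * b) v.
Proof. by rewrite /rscale scalerA rmorphM. Qed.
Fact restr_scale1 : left_id 1 rscale.
Proof. by move=> v; rewrite /rscale rmorph1 scale1r. Qed.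
Fact restr_scaleDr : right_distributive rscale +%R.
Proof. by move=> a v w; apply: scalerDr. Qed.
Fact restr_scaleDl v : {morph rscale^~ v : a b / a + b}.
Proof. by move=> a b; rewrite /rscale rmorphD scalerDl. Qed.
HB.instance Definition _ := GRing.Zmodule_isLmodule.Build A (restr phi V)
  restr_scaleA restr_scale1 restr_scaleDr restr_scaleDl.
End Instances.

Definition restr_map (V W : lmodType B) (f : {linear V -> W}) : restr phi V -> restr phi W := f.
Fact restr_map_linear (V W : lmodType B) (f : {linear V -> W}) : linear (restr_map f).
Proof. by move=> a x y; rewrite /restr_map linearP. Qed.
HB.instance Definition _ (V W : lmodType B) (f : {linear V -> W}) :=
  GRing.isLinear.Build A (restr phi V) (restr phi W) _ (restr_map f) (restr_map_linear f).

Lemma lc_restr (V : lmodType B) (I J : finType) (a : I -> J -> A) (x : J -> V) i :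
  lc a (x : J -> restr phi V) i = lc (fun i j => phi (a i j)) x i :> V.
Proof. by []. Qed.

Definition bmul (b : B) (x : restr phi B^o) : restr phi B^o := b * (x : B).
Fact bmul_linear b : linear (bmul b).
Proof.
move=> a x y; rewrite /bmul /GRing.scale /= mulrDr; congr (_ + _).
exact: mulrCA.
Qed.
HB.instance Definition _ b :=
  GRing.isLinear.Build A (restr phi B^o) (restr phi B^o) _ (bmul b) (bmul_linear b).

Section BaseChange.
Variable N : lmodType A.

(** The tensor product over [A], with [B] acting on the left factor.  When [B] is a
    localization of [A], this is the localized module. *)
Definition bc : Type := tensor (restr phi B^o) N.
HB.instance Definition _ := GRing.Zmodule.on bc.

Definition bc_scale (b : B) (x : bc) : bc :=
  tensor_map (bmul b) (idfun : {linear N -> N}) x.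

Lemma bc_scale_pure b c n :
  bc_scale b (pure_tensor (c : restr phi B^o) n) = pure_tensor (b * c : restr phi B^o) n.
Proof. exact: tensor_map_pure. Qed.

Lemma bc_ext (f g : bc -> bc) :
  (forall x y, f (x + y) = f x + f y) -> (forall x y, g (x + y) = g x + g y) ->
  (forall c n, f (pure_tensor c n) = g (pure_tensor c n)) -> forall x, f x = g x.
Proof.
move=> fD gD fg x; have [k [c [n ->]]] := tensor_tsum x.
have f0 : f 0 = 0 by apply: (addrI (f 0)); rewrite -fD !addr0.
have g0 : g 0 = 0 by apply: (addrI (g 0)); rewrite -gD !addr0.
by rewrite /tsum; elim/big_rec: _ => [|i t _ IH]; rewrite ?f0 ?g0 // fD gD IH fg.
Qed.

Fact bc_scaleDr : right_distributive bc_scale +%R.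
Proof. by move=> b x y; apply: linearD. Qed.
Fact bc_scaleA a b x : bc_scale a (bc_scale b x) = bc_scale (a * b) x.
Proof.
apply: (bc_ext (f := bc_scale a \o bc_scale b)) x => [x y|x y|c n] /=.
- by rewrite !bc_scaleDr.
- exact: bc_scaleDr.
- by rewrite !bc_scale_pure mulrA.
Qed.
Fact bc_scale1 : left_id 1 bc_scale.
Proof.
apply: (bc_ext (g := id)) => // [x y|c n]; first exact: bc_scaleDr.
by rewrite bc_scale_pure mul1r.
Qed.
Fact bc_scaleDl x : {morph bc_scale^~ x : a b / a + b}.
Proof.
move=> a b; apply: (bc_ext (g := fun x => bc_scale a x + bc_scale b x)) x => [x y|x y|c n].
- exact: bc_scaleDr.
- by rewrite !bc_scaleDr addrACA.
- by rewrite !bc_scale_pure mulrDl; apply: pureDl.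
Qed.
HB.instance Definition _ := GRing.Zmodule_isLmodule.Build B bc
  bc_scaleA bc_scale1 bc_scaleDr bc_scaleDl.

Definition bc_iota (n : N) : bc := pure_tensor (1 : restr phi B^o) n.

End BaseChange.

Definition bc_map (N N' : lmodType A) (f : {linear N -> N'}) : bc N -> bc N' :=
  tensor_map (idfun : {linear restr phi B^o -> restr phi B^o}) f.

Fact bc_map_linear (N N' : lmodType A) (f : {linear N -> N'}) : linear (bc_map f).
Proof.
have bcD x y : bc_map f (x + y) = bc_map f x + bc_map f y by apply: linearD.
have bcZ b x : bc_map f (b *: x) = b *: bc_map f x.
  have [k [c [n ->]]] := tensor_tsum x.
  rewrite -[b *: (tsum c n : bc N)]/(tensor_map (bmul b) idfun (tsum c n)).
  rewrite /bc_map !tensor_map_tsum.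
  rewrite -[RHS]/(tensor_map (bmul b) idfun (tsum _ _)) tensor_map_tsum.
  exact: eq_tsum.
by move=> b x y; rewrite bcD bcZ.
Qed.
HB.instance Definition _ (N N' : lmodType A) (f : {linear N -> N'}) :=
  GRing.isLinear.Build B (bc N) (bc N') _ (bc_map f) (bc_map_linear f).

Lemma bc_map_iota (N N' : lmodType A) (f : {linear N -> N'}) x :
  bc_map f (bc_iota x) = bc_iota (f x).
Proof. exact: tensor_map_pure. Qed.

(** * Clearing denominators *)

Definition semilin (M : lmodType A) (M' : lmodType B) (iota : M -> M') :=
  (forall x y, iota (x + y) = iota x + iota y) /\
  (forall a x, iota (a *: x) = phi a *: iota x).

Lemma bc_iota_semilin (N : lmodType A) : semilin (@bc_iota N).
Proof.
split=> [x y|a x]; first exact: pureDr.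
rewrite /bc_iota -[RHS]/(bc_scale (phi a) _) bc_scale_pure mulr1 pureZr -pureZl.
by congr (pure_tensor _ _); exact: mulr1.
Qed.

Section Semilinear.
Variables (M : lmodType A) (M' : lmodType B) (iota : M -> M').
Hypothesis iotaL : semilin iota.

Lemma semilin0 : iota 0 = 0.
Proof. by rewrite -(scale0r (0 : M)) iotaL.2 rmorph0 scale0r. Qed.

Lemma semilinB x y : iota (x - y) = iota x - iota y.
Proof. by rewrite -[- y]scaleN1r iotaL.1 iotaL.2 rmorphN1 scaleN1r. Qed.

Lemma semilin_lc (I J : finType) (a : I -> J -> A) (x : J -> M) i :
  iota (lc a x i) = lc (fun i j => phi (a i j)) (iota \o x) i.
Proof.
rewrite /lc; elim/big_rec2: _ => [|j y z _ <-]; first exact: semilin0.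
by rewrite iotaL.1 iotaL.2.
Qed.

End Semilinear.

Section Localization.
Variable g : A.

Definition is_loc (M : lmodType A) (M' : lmodType B) (iota : M -> M') :=
  semilin iota /\ module_localization_away phi iota g.

Section ModuleLoc.
Variables (M : lmodType A) (M' : lmodType B) (iota : M -> M').
Hypothesis iotaL : is_loc iota.
Implicit Types (I : finType).

(** The sum of the exponents serves as a common denominator. *)
Lemma clear_mod I (y : I -> M') :
  exists k (x : I -> M), forall i, phi g ^+ k *: y i = iota (x i).
Proof.
have [[_ iZ] [_ clr _]] := iotaL.
have /choice [x xE] := fun i => clr (y i).
have /choice [k kE] := xE.
exists (\sum_i k i)%N, (fun i => g ^+ (\sum_i k i - k i)%N *: x i) => i.
rewrite iZ -kE scalerA rmorphXn -exprD subnK //.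
by rewrite (bigD1 i) //= leq_addr.
Qed.

Lemma kill_mod I (x : I -> M) :
  (forall i, iota (x i) = 0) -> exists k, forall i, g ^+ k *: x i = 0.
Proof.
have [sl [_ _ inj]] := iotaL.
move=> x0; have /choice [k kE] : forall i, exists k, g ^+ k *: x i = 0.
  move=> i; have [|k kE] := inj (x i) 0; first by rewrite x0 semilin0.
  by exists k; rewrite kE scaler0.
exists (\sum_i k i)%N => i.
by rewrite (bigD1 i) //= addnC exprD -scalerA kE scaler0.
Qed.

Lemma kill_eq I (x y : I -> M) :
  (forall i, iota (x i) = iota (y i)) -> exists k, forall i, g ^+ k *: x i = g ^+ k *: y i.
Proof.
have [sl _] := iotaL.
move=> xy; have [i|k kE] := @kill_mod I (fun i => x i - y i).
  by rewrite semilinB // xy subrr.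
by exists k => i; apply/eqP; rewrite -subr_eq0 -scalerBr kE.
Qed.

End ModuleLoc.

Hypothesis loc : localization_away phi g.

Lemma loc_unit : exists u,
  (forall (V : lmodType B) k (v : V), u ^+ k *: (phi g ^+ k *: v) = v) /\
  (forall (V : lmodType B) k (v : V), phi g ^+ k *: (u ^+ k *: v) = v).
Proof.
have [[w gw] _ _] := loc; exists w; split=> V k v.
  by rewrite scalerA -exprMn mulrC gw expr1n scale1r.
by rewrite scalerA -exprMn gw expr1n scale1r.
Qed.

Lemma ring_is_loc : is_loc (M := A^o) (M' := B^o) phi.
Proof.
split; first by split=> [x y|a x]; [exact: rmorphD | exact: rmorphM].
by have [gu clr inj] := loc; split.
Qed.

Lemma clear_ring (I J : finType) (b : I -> J -> B) :
  exists k (a : I -> J -> A), forall i j, phi g ^+ k * b i j = phi (a i j).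
Proof.
have [k [a aE]] := clear_mod ring_is_loc (fun p : I * J => b p.1 p.2).
by exists k, (fun i j => a (i, j)) => i j; exact: aE (i, j).
Qed.

Lemma kill_ring (I J : finType) (a : I -> J -> A) :
  (forall i j, phi (a i j) = 0) -> exists k, forall i j, g ^+ k * a i j = 0.
Proof.
move=> a0.
have [p|k kE] := kill_mod ring_is_loc (x := fun p : I * J => a p.1 p.2).
  exact: a0.
by exists k => i j; exact: kE (i, j).
Qed.

Lemma kill_eq_ring (I J : finType) (a b : I -> J -> A) :
  (forall i j, phi (a i j) = phi (b i j)) ->
  exists k, forall i j, g ^+ k * a i j = g ^+ k * b i j.
Proof.
move=> ab; have [i j|k kE] := @kill_ring I J (fun i j => a i j - b i j).
  by rewrite rmorphB ab subrr.
by exists k => i j; apply/eqP; rewrite -subr_eq0 -mulrBr kE.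
Qed.

(** A system over [B] in [M'] comes from a system over [A] in [M], up to powers of
    [g] that clear the denominators and one that makes the relations hold in [M]. *)
Lemma eqflat_localize (M : lmodType A) (M' : lmodType B) (iota : M -> M') :
  is_loc iota -> eqflat M -> eqflat M'.
Proof.
move=> iL flatM I K b y by0; have [sl _] := iL.
have [u [uK _]] := loc_unit.
have [s [al alE]] := clear_ring b.
have [t [x xE]] := clear_mod iL y.
have ax0 k : iota (lc al x k) = 0.
  rewrite (semilin_lc sl) (eq_lc (b := fun k i => phi g ^+ s * b k i)
    (y := fun i => phi g ^+ t *: y i)) //.
  by rewrite lcZ lcZl by0 !scaler0.
have [r rE] := kill_mod iL ax0.
have [k|J [a [x' [xaE a0]]]] := flatM I K (fun k i => g ^+ r * al k i) x.
  by rewrite lcZl rE.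
exists J, (fun i j => phi (a i j)), (fun j => u ^+ t *: iota (x' j)); split=> [i|k j].
  rewrite lcZ -[LHS](uK _ t) xE xaE; congr (_ *: _).
  exact: semilin_lc.
have /(congr1 phi) := a0 k j; rewrite rmorph0 rmorph_sum => pa0.
have E : phi g ^+ (r + s) *: (cmul b (fun i j => phi (a i j)) k j : B^o) = 0.
  rewrite -[RHS]pa0 -[LHS]/(_ * _) mulr_sumr; apply: eq_bigr => i _.
  by rewrite !rmorphM -alE rmorphXn exprD !mulrA.
by rewrite -[LHS](uK B^o (r + s)%N) E scaler0.
Qed.

Lemma eqflat_restr (V : lmodType B) : eqflat V -> eqflat (restr phi V).
Proof.
move=> flatV I K al y ay0; have [u [uK _]] := loc_unit.
have [k|J [b [y' [yE b0]]]] := flatV I K (fun k i => phi (al k i)) y.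
  exact: ay0.
have [s [a aE]] := clear_ring b.
have [k j|r rE] := @kill_ring _ _ (cmul al a).
  transitivity (phi g ^+ s * cmul (fun k i => phi (al k i)) b k j); last by rewrite b0 mulr0.
  rewrite rmorph_sum mulr_sumr.
  by apply: eq_bigr => i _; rewrite rmorphM -aE mulrCA.
exists J, (fun i j => g ^+ r * a i j), (fun j => u ^+ (r + s) *: y' j); split=> [i|k j].
  rewrite lc_restr lcZ -[LHS](uK V (r + s)%N).
  apply: (congr1 (fun v : V => u ^+ (r + s) *: v)).
  rewrite yE -lcZl; apply: eq_lc => // i' j.
  by rewrite exprD -mulrA aE rmorphM rmorphXn.
rewrite -[RHS](rE k j) /cmul mulr_sumr; apply: eq_bigr => i _.
exact: mulrCA.
Qed.

(** If [1 (x) x = 0], then flatness of [B] over [A] gives [1 = sum_j a_j b_j] with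
    [a_j x = 0]; clearing the denominators of the [b_j] exhibits a power of [g] as
    a combination of the [a_j], hence as an annihilator of [x]. *)
Lemma bc_is_loc (N : lmodType A) : is_loc (@bc_iota N).
Proof.
split; first exact: bc_iota_semilin.
have [gu clr inj] := loc; split=> // [y|x y xy].
  have [k [c [n ->]]] := tensor_tsum y.
  have [s [a aE]] := clear_ring (fun (_ : unit) i => c i : B).
  exists (lc a n tt), s.
  rewrite -[LHS]/(tensor_map (bmul (phi g ^+ s)) idfun (tsum c n)) tensor_map_tsum.
  rewrite /lc /bc_iota pure_sumr; apply: eq_bigr => i _ /=.
  rewrite pureZr -pureZl; congr (pure_tensor _ _).
  exact: etrans (aE tt i) (esym (mulr1 _)).
have flatB : flat (restr phi B^o).
  by apply/eqflat_flat/eqflat_restr/(eqflat_localize ring_is_loc)/eqflat_regular.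
have xy0 : tsum (fun _ : unit => (1 : restr phi B^o)) (fun=> x - y) = 0.
  rewrite /tsum (big_pred1 tt); last by case.
  by rewrite -/(bc_iota _) (semilinB (bc_iota_semilin N)) xy subrr.
have [J [a [b [bE a0]]]] := flat_vanish flatB xy0.
have [s [be beE]] := clear_ring (fun (_ : unit) i => b i : B).
have [] := inj (g ^+ s) (\sum_j a tt j * be tt j).
  rewrite rmorph_sum rmorphXn -[LHS]mulr1 [X in _ * X](bE tt) mulr_sumr.
  by apply: eq_bigr => j _; rewrite rmorphM -beE mulrCA.
move=> k kE; exists (k + s)%N; apply/eqP; rewrite -subr_eq0 -scalerBr exprD kE.
apply/eqP; rewrite mulr_sumr scaler_suml big1 // => j _.
rewrite mulrA mulrAC -scalerA.
have -> : a tt j *: (x - y) = 0.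
  by rewrite -[RHS](a0 j) /lc (big_pred1 tt) //; case.
by rewrite scaler0.
Qed.

End Localization.

End Restriction.

Arguments restr_map {A B} phi {V W} f _.
Arguments bc_map {A B} phi {N N'} f _.
Arguments bc_iota {A B} phi {N} n.

(** * Tor-orthogonal classes under localization *)

Section QLoc.
Variables (A B : comPzRingType) (phi : {rmorphism A -> B}) (g : A).
Hypothesis loc : localization_away phi g.

Section RestrResolution.
Variables (V : lmodType B) (C : resolution V).
Definition restr_resolution : resolution (restr phi V) :=
  @Resolution A (restr phi V) (fun i => restr phi (C i))
    (fun i => restr_map phi (res_d C i))
    (restr_map phi (res_aug C)) (@res_aug_surj _ _ C)
    (@res_exact0 _ _ C) (@res_exactS _ _ C).
End RestrResolution.

Lemma weak_dim_restr n (V : lmodType B) :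
  weak_dim_le n V -> weak_dim_le n (restr phi V).
Proof.
move=> [C [flatC C0]]; exists (restr_resolution C); split=> [i ni|i ni].
  exact/eqflat_flat/(eqflat_restr loc)/flat_eqflat/flatC.
exact: C0.
Qed.

Lemma bc_exact (N1 N2 N3 : lmodType A) (f : {linear N1 -> N2}) (h : {linear N2 -> N3}) :
  exact_at f h -> exact_at (bc_map phi f) (bc_map phi h).
Proof.
move=> fh y; have [u [uK _]] := loc_unit loc.
have [k [x xE]] := clear_mod (bc_is_loc loc N2) (fun _ : unit => y).
split=> [hy0|[z <-]].
  have [_|r rE] := @kill_mod _ _ _ _ _ _ _ (bc_is_loc loc N3) unit (fun=> h (x tt)).
    by rewrite -bc_map_iota -(xE tt) linearZ /= hy0 scaler0.
  have [z zE] : exists z, f z = g ^+ r *: x tt by apply/fh; rewrite linearZ /= rE.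
  exists (u ^+ (r + k) *: bc_iota phi z).
  rewrite linearZ /= bc_map_iota zE (bc_iota_semilin phi N2).2 -(xE tt).
  by rewrite scalerA rmorphXn -exprD uK.
have [r [w wE]] := clear_mod (bc_is_loc loc N1) (fun _ : unit => z).
rewrite -[z](uK _ r) (wE tt) !linearZ /= !bc_map_iota.
have -> : h (f (w tt)) = 0 by apply/fh; exists (w tt).
by rewrite (semilin0 (bc_iota_semilin phi N3)) scaler0.
Qed.

Section BcResolution.
Variables (N : lmodType A) (C : resolution N).

Fact bc_aug_surj m : exists x, bc_map phi (res_aug C) x = m.
Proof.
have [u [uK _]] := loc_unit loc.
have [k [x xE]] := clear_mod (bc_is_loc loc N) (fun _ : unit => m).
have [y yE] := res_aug_surj C (x tt).
by exists (u ^+ k *: bc_iota phi y); rewrite linearZ /= bc_map_iota yE -(xE tt) uK.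
Qed.

Definition bc_resolution : resolution (bc phi N) :=
  @Resolution B (bc phi N) (fun i => bc phi (C i)) (fun i => bc_map phi (res_d C i))
    (bc_map phi (res_aug C)) bc_aug_surj
    (bc_exact (@res_exact0 _ _ C)) (fun i => bc_exact (@res_exactS _ _ C i)).
End BcResolution.

Lemma weak_dim_bc n (N : lmodType A) : weak_dim_le n N -> weak_dim_le n (bc phi N).
Proof.
move=> [C [flatC C0]]; exists (bc_resolution C); split=> [i ni|i ni y].
  exact/eqflat_flat/(eqflat_localize loc (bc_is_loc loc (C i)))/flat_eqflat/flatC.
have [u [uK _]] := loc_unit loc.
have [k [x xE]] := clear_mod (bc_is_loc loc (C i)) (fun _ : unit => y).
by rewrite -[y](uK _ k) (xE tt) (C0 _ ni (x tt)) (semilin0 (bc_iota_semilin phi _)) scaler0.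
Qed.

(** A module over the localization has the same weak dimension bound over [A].
    So a Tor triple over the localization, once its denominators are cleared, is
    null over [A]. *)
Lemma Qclass_bc n (Q : lmodType A) : Qclass n Q -> Qclass n (bc phi Q).
Proof.
move=> QQ V /weak_dim_restr /QQ /Tor1_tor_trivial tor0.
apply: tor_trivial_Tor1 => I K a b d ab0 ad0.
have [u [uK Ku]] := loc_unit loc.
have iL := bc_is_loc loc Q; have [sl _] := iL.
have [s [al alE]] := clear_ring loc a.
have [r [de deE]] := clear_mod iL d.
have [k|p pE] := @kill_mod _ _ _ _ _ _ _ iL K (lc (tr al) de).
  rewrite (semilin_lc sl) (eq_lc (b := fun k i => phi g ^+ s * tr a k i)
    (y := fun i => phi g ^+ r *: d i)) //; last by move=> k' i; rewrite /tr alE.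
  by rewrite lcZ lcZl ad0 !scaler0.
have [||I' [G [W [d' [be [ga [c [e [e' [bE gc0 abE ega0 ed0]]]]]]]]]] :=
    tor0 I K (fun i k => g ^+ p * al i k) b de.
- move=> i; rewrite lcZl lc_restr (eq_lc (b := fun i k => phi g ^+ s * a i k) (y := b)) //.
  by rewrite lcZl ab0 !scaler0.
- by move=> k; rewrite -[RHS](pE k) -lcZl.
exists I', G, W, (fun i => u ^+ (p + s + r) *: bc_iota phi (d' i)).
exists (fun i j => phi (be i j)), (fun i j => phi (ga i j)), c.
exists (fun i j => u ^+ (p + s) * phi (e i j)), (fun i j => phi (e' i j)).
split=> [k|k|i v|i v|h].
- exact: bE.
- exact: gc0.
- have /(congr1 phi) := abE i v; rewrite !rmorph_sum => E.
  have E' : phi g ^+ (p + s) *: (cmul a (fun i j => phi (be i j)) i v : B^o) =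
            \sum_j phi (e i j * ga j v).
    rewrite -E -[LHS]/(_ * _) mulr_sumr; apply: eq_bigr => j _.
    by rewrite !rmorphM -alE rmorphXn exprD !mulrA.
  rewrite -[LHS](uK B^o (p + s)%N) E' -[LHS]/(_ * _) mulr_sumr.
  by apply: eq_bigr => j _; rewrite rmorphM mulrA.
- have /(congr1 phi) := ega0 i v; rewrite rmorph_sum rmorph0 => E.
  by rewrite -[RHS]E; apply: eq_bigr => j _; rewrite rmorphM.
- have /(congr1 (@bc_iota _ _ phi Q)) := ed0 h.
  rewrite (semilin0 sl) sl.1 !(semilin_lc sl) => E.
  have -> : lc (tr (fun i j => u ^+ (p + s) * phi (e i j))) d h =
      u ^+ (p + s + r) *: lc (fun j i => phi (tr e j i)) (@bc_iota _ _ phi Q \o de) h.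
    rewrite -lcZ; apply: eq_bigr => i _ /=; rewrite /tr -deE.
    by rewrite (exprD u (p + s)%N r) -[(_ * u ^+ r) *: _]scalerA uK !scalerA mulrC.
  by rewrite lcZ -scalerDr E scaler0.
Qed.

(** Weak dimension bounds localize, so a Tor triple over [A] is null after
    localization of [b].  Clearing denominators makes it null over [A] with [b]
    replaced by a multiple [g ^+ L *: b]; this is harmless, because [g] acts
    invertibly on [Q] and the power moves across the tensor sign. *)
Lemma Qclass_restr n (Q : lmodType B) : Qclass n Q -> Qclass n (restr phi Q).
Proof.
move=> QQ N Nn P projP t; split=> [|[u <-]]; last exact: tensor_res_d0.
have /QQ /Tor1_tor_trivial tor0 := weak_dim_bc Nn.
have [m [x [d ->]]] := tensor_tsum t.
rewrite tensor_map_tsum => xd0.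
have [K [a [y [xE ad0]]]] := flat_vanish (eqflat_flat (projective_eqflat (projP 0%N))) xd0.
have [u [uK Ku]] := loc_unit loc.
have iL := bc_is_loc loc N; have [sl _] := iL.
have ab0 i : lc a (res_aug P \o y) i = 0.
  by rewrite -linear_lc -xE; apply/res_exact0; exists (x i).
have [i||I' [G [V [d' [be [ga [c [e [e' [bE gc0 abE ega0 ed0]]]]]]]]]] :=
    tor0 _ _ (fun i k => phi (a i k)) (@bc_iota _ _ phi N \o (res_aug P \o y)) (d : _ -> Q).
- by rewrite -(semilin_lc sl) ab0 (semilin0 sl).
- exact: ad0.
(* Matrices and tuples over [A] get the suffix 1; [p1], [p2], [p3] and [p4] are
   the powers of [g] needed for the four systems of equations to hold over [A]. *)
have [s [be1 be1E]] := clear_ring loc be.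
have [q [ga1 ga1E]] := clear_ring loc ga.
have [w [e1 e1E]] := clear_ring loc e.
have [w' [e'1 e'1E]] := clear_ring loc e'.
have [r [c1 c1E]] := clear_mod iL c.
have [k|p1 p1E] := @kill_eq _ _ _ _ _ _ _ iL _
    (fun k => g ^+ (s + r) *: res_aug P (y k)) (lc be1 c1).
  rewrite sl.2 [bc_iota _ _]bE (semilin_lc sl) rmorphXn exprD -scalerA -lcZ -lcZl.
  exact: eq_lc.
have [k|p2 p2E] := @kill_mod _ _ _ _ _ _ _ iL _ (lc ga1 c1).
  rewrite (semilin_lc sl) (eq_lc (b := fun i j => phi g ^+ q * ga i j)
    (y := fun i => phi g ^+ r *: c i)) //.
  by rewrite lcZ lcZl gc0 !scaler0.
have [i v|p3 p3E] := @kill_eq_ring _ _ _ _ loc _ _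
    (fun i v => g ^+ (q + w) * cmul a be1 i v) (fun i v => g ^+ s * cmul e1 ga1 i v).
  rewrite !rmorphM !rmorphXn !rmorph_sum.
  transitivity (phi g ^+ (q + w + s) * cmul (fun i k => phi (a i k)) be i v).
    rewrite [in RHS]exprD -mulrA; congr (_ * _); rewrite mulr_sumr.
    by apply: eq_bigr => j _; rewrite rmorphM -be1E mulrCA.
  rewrite abE addnC exprD -mulrA; congr (_ * _); rewrite mulr_sumr.
  by apply: eq_bigr => j _; rewrite rmorphM -e1E -ga1E [RHS]mulrACA -exprD addnC.
have [i v|p4 p4E] := @kill_ring _ _ _ _ loc _ _ (cmul e'1 ga1).
  transitivity (phi g ^+ (w' + q) * cmul e' ga i v); last by rewrite ega0 mulr0.
  rewrite rmorph_sum mulr_sumr.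
  by apply: eq_bigr => j _; rewrite rmorphM -e'1E -ga1E mulrACA -exprD.
(* [g ^+ p1] relates [b] to [be1 c1], [g ^+ p2] kills [ga1 c1], and the rest
   of [X] makes [a be1] divisible by the rescaled [ga1]. *)
pose X := (p3 + (q + w) + p2)%N.
pose L := (X + p1 + (s + r))%N.
have nul : tor_null a (fun k => g ^+ L *: res_aug P (y k))
                      ((fun i => u ^+ L *: (d i : Q)) : _ -> restr phi Q).
  exists I', G, V.
  exists (fun i => u ^+ L *: (phi g ^+ (p1 + p3 + s + w) *: (u ^+ (p4 + w') *: (d' i : Q)))).
  exists (fun k v => g ^+ (X + p1) * be1 k v), (fun k v => g ^+ p2 * ga1 k v), c1.
  exists (fun i j => g ^+ (p1 + p3 + s) * e1 i j), (fun i j => g ^+ p4 * e'1 i j).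
  split=> [k|k|i v|i v|h].
  - by rewrite lcZl (exprD g X p1) -scalerA -p1E !scalerA -!exprD.
  - by rewrite lcZl p2E.
  - rewrite /cmul; transitivity (g ^+ (X + p1) * cmul a be1 i v).
      by rewrite mulr_sumr; apply: eq_bigr => j _; rewrite mulrCA.
    transitivity (g ^+ (p1 + p3 + s + p2) * cmul e1 ga1 i v); last first.
      by rewrite mulr_sumr; apply: eq_bigr => j _; rewrite [RHS]mulrACA -exprD.
    have -> : (X + p1 = p1 + p2 + (p3 + (q + w)))%N by rewrite /X; lia.
    have -> : (p1 + p3 + s + p2 = p1 + p2 + (p3 + s))%N by lia.
    rewrite !(exprD g (p1 + p2)%N) -!mulrA; congr (_ * _).
    by rewrite !(exprD g p3) -!mulrA p3E.
  - transitivity (g ^+ p2 * (g ^+ p4 * cmul e'1 ga1 i v)); last by rewrite p4E mulr0.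
    rewrite !mulr_sumr; apply: eq_bigr => j _.
    by rewrite mulrACA [RHS]mulrA [g ^+ p4 * _]mulrC.
  - have E1 : lc (tr (fun i j => g ^+ (p1 + p3 + s) * e1 i j))
                 ((fun i => u ^+ L *: (d i : Q)) : _ -> restr phi Q) h =
              u ^+ L *: (phi g ^+ (p1 + p3 + s + w) *: (lc (tr e) (d : _ -> Q) h)) :> Q.
      rewrite -!lcZ; apply: eq_bigr => i _.
      rewrite -[LHS]/(phi _ *: (u ^+ L *: (d i : Q))) /tr rmorphM rmorphXn -e1E.
      rewrite mulrA -exprD !scalerA; congr (_ *: _).
      by rewrite [RHS]mulrA [RHS]mulrC mulrA.
    have E2 : lc (tr (fun i j => g ^+ p4 * e'1 i j))
                 ((fun i => u ^+ L *: (phi g ^+ (p1 + p3 + s + w) *: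
                     (u ^+ (p4 + w') *: (d' i : Q)))) : _ -> restr phi Q) h =
              u ^+ L *: (phi g ^+ (p1 + p3 + s + w) *: (lc (tr e') (d' : _ -> Q) h)) :> Q.
      rewrite -!lcZ; apply: eq_bigr => i _.
      rewrite -[LHS]/(phi _ *: (_ : Q)) /tr rmorphM rmorphXn -e'1E.
      rewrite mulrA -exprD -[in RHS](Ku Q (p4 + w')%N (d' i)) !scalerA.
      congr (_ *: _); rewrite -!mulrA [LHS]mulrCA; congr (_ * _).
      by rewrite mulrCA; congr (_ * _); rewrite mulrCA.
    rewrite [X in X + _]E1 [X in _ + X]E2.
    by rewrite -[LHS]/((_ : Q) + _) -!scalerDr ed0 !scaler0.
have [|||t' t'E] := @tor_null_boundary _ _ _ P _ _ a (fun i => g ^+ L *: x i)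
   (fun k => g ^+ L *: y k) ((fun i => u ^+ L *: (d i : Q)) : _ -> restr phi Q).
- by move=> i; rewrite linearZ /= [res_d _ _ _]xE lcZ.
- move=> k; transitivity (u ^+ L *: (lc (tr a) d k : Q)); last first.
    by rewrite ad0; exact: (@scaler0 B Q).
  exact: (@lcZ B Q _ _ (fun k i => phi (a i k)) (d : _ -> Q) (u ^+ L) k).
- have -> : res_aug P \o (fun k => g ^+ L *: y k) = (fun k => g ^+ L *: res_aug P (y k)).
    by apply: functional_extensionality_dep => k /=; rewrite linearZ.
  exact: nul.
exists t'; rewrite t'E tsumZl -tsumZr; apply: eq_tsum => // i.
by rewrite -[LHS]/(phi (g ^+ L) *: (u ^+ L *: (d i : Q))) rmorphXn Ku.
Qed.

End QLoc.

(** * Ascent *)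

Lemma flat_mlP (R : comPzRingType) n (M : lmodType R) :
  flat_mittag_leffler n M <-> eqflat M /\ eq_ml (@Qclass R n) M.
Proof.
split=> [[flatM mlM]|[/eqflat_flat flatM mlM]].
  by split; [apply: flat_eqflat | apply: mittag_leffler_eq_ml].
by split=> //; apply: eq_ml_mittag_leffler.
Qed.

Section Ascent.
Variables (A B : comPzRingType) (phi : {rmorphism A -> B}) (g : A).
Hypothesis loc : localization_away phi g.
Variables (M : lmodType A) (M' : lmodType B) (iota : M -> M').
Hypothesis iL : is_loc phi g iota.

(** A tuple of [M'] is, up to a unit, the image of a tuple [mu] of [M], and the
    matrix that serves [mu] over [A] also serves it over [B]: a module of the class
    over [B] is in the class over [A], and a tensor that vanishes over [B] vanishes
    over [A], since [g] is invertible on the second factor. *)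
Lemma eq_ml_localize n :
  eqflat M -> eq_ml (@Qclass A n) M -> eq_ml (@Qclass B n) M'.
Proof.
move=> flatM mlM I m; have [sl _] := iL; have [u [uK Ku]] := loc_unit loc.
have [N [mu muE]] := clear_mod iL m.
have [J [a [mu' [muaE mla]]]] := mlM I mu.
exists J, (fun i j => phi (a i j)), (fun j => u ^+ N *: iota (mu' j)); split=> [i|D q QD].
  rewrite lcZ -[LHS](uK _ N) muE muaE; congr (_ *: _).
  exact: semilin_lc.
move=> [J' [b [m'' [mE bq0]]]].
have [s [be beE]] := clear_ring loc b.
have [t [nu nuE]] := clear_mod iL m''.
have [i|p pE] := @kill_eq _ _ _ _ _ _ _ iL I
    (fun i => g ^+ (s + t) *: mu i) (fun i => g ^+ N *: lc be nu i).
  rewrite !sl.2 (semilin_lc sl) -muE !rmorphXn mE scalerA mulrC -scalerA.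
  congr (_ *: _); rewrite exprD -scalerA -lcZ -lcZl.
  by apply: eq_lc.
pose P := (p + (s + t))%N.
have van : eq_vanish mu (q : I -> restr phi D).
  apply: flat_vanish; first exact: eqflat_flat.
  rewrite (@eq_tsum _ _ _ _ _ mu _ (fun i => g ^+ P *: ((u ^+ P *: (q i : D)) : restr phi D))) //.
    rewrite tsumZr -tsumZl.
    rewrite (@eq_tsum _ _ _ _ _ (lc (fun i j => g ^+ (p + N) * be i j) nu) _
                  (fun i => (u ^+ P *: (q i : D)) : restr phi D)) //.
      rewrite tsum_lc tsum0r // => j.
      transitivity (u ^+ P *: (phi g ^+ (p + N + s) *: lc (tr b) q j) : D).
        rewrite -!lcZ; apply: eq_bigr => i _.
        rewrite -[LHS]/(phi _ *: (_ : D)) /tr rmorphM rmorphXn -beE !scalerA.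
        apply: (congr1 (fun c => c *: (q i : D))).
        by rewrite [X in X * _ = _]mulrA -exprD [RHS]mulrA [RHS]mulrC mulrA.
      by rewrite bq0 !scaler0.
    by move=> i; rewrite lcZl /P !(exprD g p) -!(scalerA (g ^+ p)) pE.
  move=> i; rewrite -[RHS]/(phi (g ^+ P) *: (u ^+ P *: (q i : D))) rmorphXn.
  exact/esym/Ku.
by move=> j; exact: (mla (restr phi D) q (Qclass_restr loc QD) van j).
Qed.

Lemma flat_ml_localize n : flat_mittag_leffler n M -> flat_mittag_leffler n M'.
Proof.
move=> /flat_mlP [flatM mlM]; apply/flat_mlP; split.
  exact: eqflat_localize iL flatM.
exact: eq_ml_localize.
Qed.

End Ascent.

(** * Ideals *)

Section Ideals.
Variable A : comPzRingType.

(** [S] generates the unit ideal.  Quantifying over ideals makes this usable with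
    ideals of elements for which some local property holds. *)
Definition unit_ideal (S : set A) : Prop :=
  forall K : set A, is_ideal K -> S `<=` K -> K 1.

Lemma ideal_sum (K : set A) (I : finType) (x : I -> A) :
  is_ideal K -> (forall i, K (x i)) -> K (\sum_i x i).
Proof. by move=> [K0 KD _] Kx; elim/big_rec: _ => // i y _; apply: KD. Qed.

Lemma ideal_le (K : set A) x k l : is_ideal K -> (k <= l)%N -> K (x ^+ k) -> K (x ^+ l).
Proof. by move=> [_ _ KM] kl Kx; rewrite -(subnK kl) exprD; apply: (KM). Qed.

Lemma ideal_binomial (K : set A) x y k l :
  is_ideal K -> K (x ^+ k) -> K (y ^+ l) -> K ((x + y) ^+ (k + l)).
Proof.
move=> idK Kx Ky; have [_ _ KM] := idK; rewrite exprDn.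
apply: ideal_sum => // i; rewrite -mulr_natl; apply: (KM).
have [li|il] := leqP l i; first by apply: (KM); apply: ideal_le li Ky.
rewrite mulrC; apply: (KM); apply: ideal_le Kx => //; lia.
Qed.

(** The radical of [K] is an ideal. *)
Lemma unit_ideal_pow (S K : set A) :
  unit_ideal S -> is_ideal K -> (forall f, S f -> exists k, K (f ^+ k)) -> K 1.
Proof.
move=> S1 idK SK; have [K0 KD KM] := idK.
suff [k] : exists k, K (1 ^+ k) by rewrite expr1n.
apply: (S1 [set x | exists k, K (x ^+ k)]) => //; split=> /=.
- by exists 1%N; rewrite expr1.
- by move=> x y [k Kx] [l Ky]; exists (k + l)%N; apply: ideal_binomial.
- by move=> a x [k Kx]; exists k; rewrite exprMn; apply: (KM).
Qed.

Lemma annihilator_ideal (M : lmodType A) (I : Type) (v : I -> M) :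
  is_ideal [set c | forall i, c *: v i = 0].
Proof.
split=> [i|x y x0 y0 i|a x x0 i] /=; first by rewrite scale0r.
  by rewrite scalerDl x0 y0 addr0.
by rewrite -scalerA x0 scaler0.
Qed.

Lemma unit_ideal_finite (S : set A) : unit_ideal S ->
  exists (k : nat) (f c : 'I_k -> A), (forall i, S (f i)) /\ \sum_i c i * f i = 1.
Proof.
move=> S1.
pose K := [set x | exists (J : finType) (f c : J -> A),
  (forall i, S (f i)) /\ \sum_i c i * f i = x].
suff [J [f [c [Sf fc]]]] : K 1.
  exists #|J|, (f \o enum_val), (c \o enum_val); split=> [i|]; first exact: Sf.
  by rewrite -fc [RHS](reindex _ (onW_bij _ (enum_val_bij J))).
apply: S1 => [|f Sf].
  split.
  - by exists void, (fun i : void => 0), (fun=> 0); split=> [[]|]; rewrite big1 // => -[].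
  - move=> x y [J [f [c [Sf <-]]]] [J' [f' [c' [Sf' <-]]]].
    exists (J + J')%type, (blk_col f f'), (blk_col c c'); split=> [[]|] //.
    by rewrite big_sumType.
  - move=> a x [J [f [c [Sf <-]]]]; exists J, f, (fun i => a * c i); split=> //.
    by rewrite mulr_sumr; apply: eq_bigr => i _; rewrite mulrA.
exists unit, (fun=> f), (fun=> 1); split=> //.
by rewrite (big_pred1 tt) ?mul1r //; case.
Qed.

End Ideals.

(** * Descent *)

Section Descent.
Variables (n : nat) (A : comPzRingType) (M : lmodType A).

Definition flat_ml_at (f : A) : Prop :=
  exists (B : comPzRingType) (phi : {rmorphism A -> B}) (M' : lmodType B) (iota : M -> M'),
    [/\ localization_away phi f, is_loc phi f iota & flat_mittag_leffler n M'].

Variable S : set A.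
Hypotheses (S1 : unit_ideal S) (Sml : forall f, S f -> flat_ml_at f).

(** The ring elements [f] such that [f m] has a factorization annihilated by [alpha]
    form an ideal: factorizations add up by blocks.  It contains a power of every
    element of [S]. *)
Lemma eqflat_descent : eqflat M.
Proof.
move=> I K al m am0.
pose X := [set f : A | exists (J : finType) (a : I -> J -> A) (m' : J -> M),
  (forall i, f *: m i = lc a m' i) /\ forall k j, cmul al a k j = 0].
suff [J [a [m' [mE a0]]]] : X 1.
  by exists J, a, m'; split=> // i; rewrite -mE scale1r.
apply: (unit_ideal_pow S1) => [|f /Sml [B [phi [M' [iota [loc iL /flat_mlP [flatM' _]]]]]]].
  split.
  - exists void, (fun _ _ => 0), (fun=> 0); split=> [i|k []].
    by rewrite scale0r /lc big1 // => -[].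
  - move=> x y [J [a [m' [mE a0]]]] [J' [b [m'' [mE' b0]]]].
    exists (J + J')%type, (blk_row a b), (blk_col m' m''); split=> [i|k [j|j]].
    + by rewrite lc_row scalerDl mE mE'.
    + exact: a0.
    + exact: b0.
  - move=> c x [J [a [m' [mE a0]]]]; exists J, a, (fun j => c *: m' j); split=> // i.
    by rewrite lcZ -scalerA mE.
have [sl _] := iL; have [u [uK _]] := loc_unit loc.
have [k|J [b [y [yE b0]]]] := flatM' I K (fun k i => phi (al k i)) (iota \o m).
  by rewrite -(semilin_lc sl) am0 (semilin0 sl).
have [s [a aE]] := clear_ring loc b.
have [t [x xE]] := clear_mod iL y.
have [k j|r rE] := @kill_ring _ _ _ _ loc _ _ (cmul al a).
  transitivity (phi f ^+ s * cmul (fun k i => phi (al k i)) b k j); last by rewrite b0 mulr0.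
  rewrite rmorph_sum mulr_sumr.
  by apply: eq_bigr => i _; rewrite rmorphM -aE mulrCA.
have [i|p pE] := @kill_eq _ _ _ _ _ _ _ iL I
    (fun i => f ^+ (s + t) *: m i) (lc a x).
  rewrite sl.2 (semilin_lc sl) [iota _]yE rmorphXn exprD -scalerA -lcZ -lcZl.
  exact: eq_lc.
exists (r + p + (s + t))%N, J, (fun i j => f ^+ r * a i j), (fun j => f ^+ p *: x j).
split=> [i|k j].
  by rewrite lcZl lcZ !exprD -!scalerA -pE exprD -scalerA.
by rewrite -[RHS](rE k j) /cmul mulr_sumr; apply: eq_bigr => i _; rewrite mulrCA.
Qed.

(** The elements [f] such that every factorization of [m] can be refined to one that
    works up to powers of [f] form an ideal.  Refining first for one element and
    then for another serves both at once, as refinement preserves what has been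
    achieved; the exponents may depend on [q]. *)
Lemma eq_ml_descent : eq_ml (@Qclass A n) M.
Proof.
move=> I m; have flatM := eqflat_descent.
pose X := [set f : A | forall (J : finType) (a : I -> J -> A) (m' : J -> M),
  (forall i, m i = lc a m' i) ->
  exists (J' : finType) (be : J -> J' -> A) (nu : J' -> M),
    (forall j, m' j = lc be nu j) /\
    forall (D : lmodType A) (q : I -> D), Qclass n D -> eq_vanish m q ->
    exists k, forall j, f ^+ k *: lc (tr (cmul a be)) q j = 0].
suff X1 : X 1.
  have [i|J [a [nu [mE mla]]]] := X1 I (@delta A I) m; first by rewrite lc1.
  exists J, a, nu; split=> // D q QD mq j; have [k kE] := mla D q QD mq.
  have := kE j; rewrite expr1n scale1r lc_tr_cmul => <-.
  by apply: eq_lcr => i; rewrite lc1tr.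
apply: S1 => [|f /Sml [B [phi [M' [iota [loc iL /flat_mlP [_ mlM']]]]]] J a m' mE].
  split.
  - move=> J a m' mE; exists J, (@delta A J), m'; split=> [j|D q _ _]; first by rewrite lc1.
    by exists 1%N => j; rewrite expr1 scale0r.
  - move=> x y Xx Xy J a m' mE.
    have [J1 [b1 [m1 [m1E H1]]]] := Xx J a m' mE.
    have [i|J2 [b2 [m2 [m2E H2]]]] := Xy J1 (cmul a b1) m1.
      by rewrite -lcA mE; apply: eq_lcr.
    exists J2, (cmul b1 b2), m2; split=> [j|D q QD mq].
      by rewrite -lcA m1E; apply: eq_lcr.
    have [k kE] := H1 D q QD mq; have [l lE] := H2 D q QD mq.
    have cA j : lc (tr (cmul a (cmul b1 b2))) q j = lc (tr (cmul (cmul a b1) b2)) q j.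
      by rewrite !lc_tr_cmul; apply: eq_lcr => j'; rewrite lc_tr_cmul.
    exists (k + l)%N; apply: (ideal_binomial (annihilator_ideal _)) => j; rewrite cA //.
    rewrite lc_tr_cmul -lcZ lc0 // => j'; exact: kE.
  - move=> c x Xx J a m' mE; have [J' [be [nu [nuE H]]]] := Xx J a m' mE.
    exists J', be, nu; split=> // D q QD mq; have [k kE] := H D q QD mq.
    by exists k => j; rewrite exprMn -scalerA kE scaler0.
have [sl _] := iL; have [u [uK _]] := loc_unit loc.
have [J2 [b [y [yE mlb]]]] := mlM' I (iota \o m).
have [s [be0 be0E]] := clear_ring loc b.
have [t [mu muE]] := clear_mod iL y.
have [i|p pE] := @kill_eq _ _ _ _ _ _ _ iL I
    (fun i => f ^+ (s + t) *: m i) (lc be0 mu).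
  rewrite sl.2 (semilin_lc sl) [iota _]yE rmorphXn exprD -scalerA -lcZ -lcZl.
  exact: eq_lc.
(* The given factorization and the one coming from [f] agree up to powers of [f];
   flatness of [M] gives a common refinement. *)
pose P := (p + (s + t))%N.
have [i|J' [bg [nu [nuE rel0]]]] := flatM _ _
    (blk_row (fun i j => f ^+ P * a i j) (fun i j => (- f ^+ p) * be0 i j))
    (blk_col m' mu).
  by rewrite lc_row !lcZl -mE scaleNr -pE /P (exprD f p) -scalerA subrr.
exists J', (fun j => bg (inl j)), nu; split=> [j|D q QD [J3 [b3 [m3 [m3E b3q]]]]].
  exact: nuE (inl j).
have [slD _] := bc_is_loc loc D.
have van : eq_vanish (iota \o m) (@bc_iota _ _ phi D \o q).
  exists J3, (fun i j => phi (b3 i j)), (iota \o m3); split=> [i|j].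
    by rewrite /= m3E (semilin_lc sl).
  rewrite -[RHS](semilin0 slD) -(b3q j) (semilin_lc slD).
  exact: eq_bigr.
have bq0 := mlb _ _ (Qclass_bc loc QD) van.
have [j|r rE] := @kill_mod _ _ _ _ _ _ _ (bc_is_loc loc D) _ (lc (tr be0) q).
  rewrite (semilin_lc slD) (eq_lc (b := fun j i => phi f ^+ s * tr b j i)
    (y := @bc_iota _ _ phi D \o q)) //; last by move=> j' i; rewrite /tr be0E.
  by rewrite lcZl bq0 scaler0.
exists (r + P)%N => j.
have -> : f ^+ (r + P) *: lc (tr (cmul a (fun j => bg (inl j)))) q j =
          f ^+ p *: lc (tr (fun j => bg (inr j))) (fun j => f ^+ r *: lc (tr be0) q j) j.
  rewrite lcZ exprD -!scalerA [RHS]scalerA [_ * f ^+ r]mulrC -scalerA; congr (_ *: _).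
  rewrite -lc_tr_cmul -!lcZl; apply: eq_lc => // {}j i.
  have := rel0 i j; rewrite /cmul big_sumType /= => /eqP; rewrite addr_eq0 => /eqP E.
  rewrite /tr /cmul !mulr_sumr; under eq_bigr => k _ do rewrite mulrA.
  by rewrite E -sumrN; apply: eq_bigr => k _; rewrite !mulNr opprK mulrA.
by rewrite lc0 ?scaler0.
Qed.

Lemma flat_ml_descent : flat_mittag_leffler n M.
Proof. by apply/flat_mlP; split; [apply: eqflat_descent | apply: eq_ml_descent]. Qed.

End Descent.

(** * Prime ideals and iterated localization *)

Section Primes.
Variable A : comPzRingType.

(** A maximal proper ideal containing [K] is prime.  The empty set is admitted in the
    application of Zorn's lemma only because the union of the empty chain is
    empty. *)
Lemma prime_avoiding_one (K : set A) :
  is_ideal K -> ~ K 1 -> exists p : spectrum A, K `<=` p.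
Proof.
move=> idK K1; have [K0 _ _] := idK.
pose P (Y : set A) := (Y = set0 \/ (is_ideal Y /\ K `<=` Y)) /\ ~ Y 1.
have [F FP Ftot|Y [[YP Y1] maxY]] := @Zorn_bigcup A P.
  split; last by move=> [Z /FP [_ Z1] /Z1].
  have [[Z FZ Z0]|F0] := pselect (exists2 Z, F Z & Z <> set0); last first.
    left; apply/seteqP; split=> // x [Z FZ Zx]; apply: F0; exists Z => // Z0.
    by move: Zx; rewrite Z0.
  have idF Z' : F Z' -> Z' <> set0 -> is_ideal Z' /\ K `<=` Z'.
    by move=> /FP [[]].
  have ne (Z' : set A) (x : A) : Z' x -> Z' <> set0 by move=> Z'x Z'0; move: Z'x; rewrite Z'0.
  right; split; last by move=> x Kx; exists Z => //; apply: (idF Z FZ Z0).2.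
  split=> [|x y [Z1 F1 Z1x] [Z2 F2 Z2y]|a x [Z1 F1 Z1x]].
  - by exists Z => //; have [[? _ _] _] := idF Z FZ Z0.
  - have [[_ D1 _] _] := idF _ F1 (ne _ _ Z1x); have [[_ D2 _] _] := idF _ F2 (ne _ _ Z2y).
    have [Z12|Z21] := Ftot _ _ F1 F2.
      by exists Z2 => //; apply: D2 => //; apply: Z12.
    by exists Z1 => //; apply: D1 => //; apply: Z21.
  - by exists Z1 => //; have [[_ _ M1] _] := idF _ F1 (ne _ _ Z1x); apply: M1.
have [idY KY] : is_ideal Y /\ K `<=` Y.
  case: YP => // Y0; exfalso; apply: (maxY K); last by split=> //; right; split=> // x.
  by rewrite Y0; split=> // /(_ 0 K0).
have [Y0 YD YM] := idY.
suff Yprime a b : Y (a * b) -> Y a \/ Y b by exists (PrimeIdeal idY Y1 Yprime).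
move=> Yab; have [|na] := pselect (Y a); [by left|right].
pose Z := [set x | exists m c, Y m /\ x = m + c * a].
have Za : Z a by exists 0, 1; rewrite mul1r add0r.
have YZ : Y `<=` Z by move=> x Yx; exists x, 0; rewrite mul0r addr0.
have [m [c [Ym E1]]] : Z 1.
  apply: contrapT => Z1; apply: (maxY Z); first by split=> // ZY; apply/na/ZY.
  split=> //; right; split; last exact: subset_trans KY YZ.
  split=> [|x y [m [c [Ym ->]]] [m' [c' [Ym' ->]]]|d x [m [c [Ym ->]]]].
  - exact: YZ.
  - by exists (m + m'), (c + c'); split; [exact: YD|rewrite mulrDl addrACA].
  - by exists (d * m), (d * c); split; [exact: YM|rewrite mulrDr mulrA].
rewrite -[b]mul1r E1 mulrDl; apply: YD; first by rewrite mulrC; apply: YM.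
by rewrite -mulrA; apply: YM.
Qed.

Lemma prime_exp (p : spectrum A) a k : prime_set p (a ^+ k) -> prime_set p a.
Proof.
elim: k => [|k IH]; first by rewrite expr0 => /(@prime_proper _ p).
by rewrite exprS => /(@Defs.primeP _ p) [].
Qed.

End Primes.

Section LocComp.
Variables (A B C : comPzRingType) (phi : {rmorphism A -> B}) (psi : {rmorphism A -> C})
  (chi : {rmorphism B -> C}).
Hypothesis psiE : forall a, psi a = chi (phi a).

(** The localization at [s r] is the localization at [t] of the localization at [s],
    when [r] is a numerator of [t]. *)
Lemma module_loc_factor (M : lmodType A) (M' : lmodType B) (M'' : lmodType C)
    (iota : M -> M') (kappa : M -> M'') (lambda : M' -> M'') (s r : A) (t : B) (k : nat) :
    (forall x, kappa x = lambda (iota x)) ->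
    (forall a x, iota (a *: x) = phi a *: iota x) ->
    (forall b x, lambda (b *: x) = chi b *: lambda x) ->
    phi s ^+ k * t = phi r ->
    module_localization_away phi iota s ->
    module_localization_away psi kappa (s * r) ->
  module_localization_away chi lambda t.
Proof.
move=> kE iZ lZ st [[v sv] clr inj] [[w srw] clr2 inj2].
have tsr : psi (s * r) = chi (phi s ^+ k.+1 * t).
  by rewrite psiE rmorphM -st exprS mulrA.
have vK (V : lmodType B) l (y : V) : v ^+ l *: (phi s ^+ l *: y) = y.
  by rewrite scalerA -exprMn mulrC sv expr1n scale1r.
split.
- by exists (chi (phi s ^+ k.+1) * w); rewrite mulrCA mulrA -rmorphM -tsr.
- move=> z; have [x [l xE]] := clr2 z.
  exists (v ^+ (k.+1 * l) *: iota x), l.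
  rewrite lZ -kE -xE tsr -!(rmorphXn chi) scalerA -rmorphM exprMn -exprM mulrA -exprMn.
  by rewrite [v * _]mulrC sv expr1n mul1r.
- move=> y y' yy'; have [x [l xE]] := clr y; have [x' [l' x'E]] := clr y'.
  have [m mE] : exists m, (s * r) ^+ m *: (s ^+ l' *: x) = (s * r) ^+ m *: (s ^+ l *: x').
    apply: inj2; rewrite !kE !iZ -xE -x'E !rmorphXn !scalerA -!exprD addnC.
    by rewrite !lZ yy'.
  exists m.
  have := congr1 iota mE; rewrite !iZ -xE -x'E.
  have -> : phi ((s * r) ^+ m) = phi s ^+ (k.+1 * m) * t ^+ m.
    by rewrite rmorphXn rmorphM -st exprM -exprMn exprS mulrA.
  rewrite !rmorphXn => E.
  have perm z : phi s ^+ (k.+1 * m + (l + l')) *: (t ^+ m *: z) =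
      phi s ^+ (k.+1 * m) * t ^+ m *: (phi s ^+ l' *: (phi s ^+ l *: z)).
    rewrite !scalerA !exprD; congr (_ *: _); rewrite -!mulrA; congr (_ * _).
    by rewrite mulrC mulrA [_ * t ^+ m]mulrC mulrC mulrCA [RHS]mulrCA [_ * phi s ^+ l']mulrC.
  have sw : phi s ^+ l *: (phi s ^+ l' *: y') = phi s ^+ l' *: (phi s ^+ l *: y').
    by rewrite !scalerA mulrC.
  by rewrite -[LHS](vK _ (k.+1 * m + (l + l'))%N) perm E sw -perm vK.
Qed.

End LocComp.

(** * Non-vanishing loci *)

Section RingedSpace.
Variable X : ringed_space.
Implicit Types U V W : opens X.

Lemma rs_res_comp U V W (VU : V `<=` U) (WV : W `<=` V) (WU : W `<=` U) s :
  rs_res WV (rs_res VU s) = rs_res WU s.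
Proof. by have [_ H _] := @rs_sheaf X; apply: H. Qed.

Lemma rs_res_id U (UU : U `<=` U) s : rs_res UU s = s.
Proof. by have [H _ _] := @rs_sheaf X; apply: H. Qed.

Definition unit_on U (s : rs_ring U) V : Prop :=
  exists (VU : V `<=` U) b, rs_res VU s * b = 1.

Lemma unit_on_sub U (s : rs_ring U) V W : W `<=` V -> unit_on s V -> unit_on s W.
Proof.
move=> WV [VU [b sb]]; exists (subset_trans WV VU), (rs_res WV b).
by rewrite -(rs_res_comp VU WV) -rmorphM sb rmorph1.
Qed.

(** The points near which [s] is invertible.  This agrees with the image of the basic
    open set in every chart, and its being intrinsic is what allows to compare
    different charts. *)
Definition nonvan U (s : rs_ring U) : set X :=
  \bigcup_(V in [set V | unit_on s V]) opens_set V.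

Lemma nonvan_open U (s : rs_ring U) : open (nonvan s).
Proof. by apply: bigcup_open => V _; exact: opens_open. Qed.

Definition nonvan_opens U (s : rs_ring U) : opens X := Opens (nonvan_open s).

Lemma nonvan_sub U (s : rs_ring U) : nonvan s `<=` U.
Proof. by move=> x [V [VU _]] Vx; apply: VU. Qed.

Lemma nonvan_res U V (VU : V `<=` U) (s : rs_ring U) :
  nonvan (rs_res VU s) = (V : set X) `&` nonvan s.
Proof.
apply/seteqP; split=> [x [W [WV [b sb]]] Wx|x [Vx [W sW Wx]]].
  split; first by have := WV; apply.
  exists W => //; exists (subset_trans WV VU), b.
  by rewrite -(rs_res_comp VU WV).
exists (opensI V W) => //.
have [IU [b sb]] := unit_on_sub (@opensIr _ V W) sW.
exists (@opensIl _ V W), b; by rewrite (rs_res_comp _ _ IU).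
Qed.

Lemma nonvanM U (s t : rs_ring U) : nonvan (s * t) = nonvan s `&` nonvan t.
Proof.
apply/seteqP; split=> [x [V [VU [b stb]]] Vx|x [[V sV Vx] [W tW Wx]]].
  move: stb; rewrite rmorphM => stb.
  split; exists V => //; exists VU.
    by exists (rs_res VU t * b); rewrite mulrA.
  by exists (rs_res VU s * b); rewrite mulrCA mulrA.
exists (opensI V W) => //.
have [IU [b sb]] := unit_on_sub (@opensIl _ V W) sV.
have [IU' [c tc]] := unit_on_sub (@opensIr _ V W) tW.
exists IU, (b * c); rewrite rmorphM mulrACA sb.
by rewrite (Prop_irrelevance IU IU') tc mulr1.
Qed.

Lemma nonvan_unit U (s b : rs_ring U) : s * b = 1 -> nonvan s = U.
Proof.
move=> sb; apply/seteqP; split=> [|x Ux]; first exact: nonvan_sub.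
by exists U => //; exists (@subset_refl _ _), b; rewrite rs_res_id.
Qed.

Lemma nonvanX U (s b : rs_ring U) k : s * b = 1 -> nonvan (s ^+ k) = U.
Proof. by move=> sb; apply: (@nonvan_unit _ _ (b ^+ k)); rewrite -exprMn sb expr1n. Qed.

(** The locus is compared with [V] as a set, which avoids transporting sections along
    an equality of opens. *)
Definition ring_localizing U : Prop := forall (s : rs_ring U) V (VU : V `<=` U),
  V = nonvan s :> set X -> localization_away (rs_res VU) s.

Variable M : sheaf_of_modules X.

Lemma sm_res_comp U V W (VU : V `<=` U) (WV : W `<=` V) (WU : W `<=` U) (m : M U) :
  sm_res M WV (sm_res M VU m) = sm_res M WU m.
Proof. by have [_ H _] := @sm_sheaf X M; apply: H. Qed.

Lemma sm_res_id U (UU : U `<=` U) (m : M U) : sm_res M UU m = m.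
Proof. by have [H _ _] := @sm_sheaf X M; apply: H. Qed.

Lemma sm_resZ U V (VU : V `<=` U) a (m : M U) :
  sm_res M VU (a *: m) = rs_res VU a *: sm_res M VU m.
Proof. by rewrite linearZ. Qed.

Lemma sm_res_semilin U V (VU : V `<=` U) : semilin (rs_res VU) (sm_res M VU).
Proof. by split=> [x y|a x]; rewrite ?linearD // sm_resZ. Qed.

Lemma sm_glue U (I : Type) (W : I -> opens X) (WU : forall i, W i `<=` U) :
  U `<=` \bigcup_i W i ->
  forall s : forall i, M (W i),
  (forall i j, sm_res M (@opensIl _ (W i) (W j)) (s i)
             = sm_res M (@opensIr _ (W i) (W j)) (s j)) ->
  exists t : M U, forall i, sm_res M (WU i) t = s i.
Proof.
have [_ _ H] := @sm_sheaf X M => UW s sE.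
by have [t [tE _]] := H U I W WU UW s sE; exists t.
Qed.

Lemma sm_separated U (I : Type) (W : I -> opens X) (WU : forall i, W i `<=` U) :
  U `<=` \bigcup_i W i ->
  forall x y : M U, (forall i, sm_res M (WU i) x = sm_res M (WU i) y) -> x = y.
Proof.
have [_ _ H] := @sm_sheaf X M => UW x y xy.
have [i j|t [_ tU]] := H U I W WU UW (fun i => sm_res M (WU i) x).
  have IU : opensI (W i) (W j) `<=` U by move=> z [/WU].
  by rewrite !(sm_res_comp _ _ IU).
by rewrite -(tU x) // -(tU y) // => i; rewrite xy.
Qed.

Definition mod_localizing U : Prop := forall (s : rs_ring U) V (VU : V `<=` U),
  V = nonvan s :> set X -> module_localization_away (rs_res VU) (sm_res M VU) s.

Definition localizing U : Prop := ring_localizing U /\ mod_localizing U.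

Lemma localizing_is_loc U (s : rs_ring U) V (VU : V `<=` U) :
  localizing U -> V = nonvan s :> set X ->
  localization_away (rs_res VU) s /\ is_loc (rs_res VU) s (sm_res M VU).
Proof.
move=> [rg mg] VE; split; first exact: rg.
by split; [exact: sm_res_semilin | exact: mg].
Qed.

(** Over the locus of [s], a section [t] becomes a restriction [r] after
    multiplication by a power of the unit [s], so that its locus there is the locus
    of [s * r]. *)
Lemma localizing_nonvan U (s : rs_ring U) V :
  localizing U -> V = nonvan s :> set X -> localizing V.
Proof.
move=> [rg mg] VE.
have VU : V `<=` U by rewrite VE; exact: nonvan_sub.
have [[b sb] clr inj] := rg s V VU VE.
have key (t : rs_ring V) W (WV : W `<=` V) : W = nonvan t :> set X ->
    exists r k, rs_res VU s ^+ k * t = rs_res VU r /\ W = nonvan (s * r) :> set X.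
  move=> WE; have [r [k rE]] := clr t; exists r, k; split=> //.
  rewrite WE nonvanM -VE -nonvan_res -rE nonvanM (nonvanX _ sb).
  by apply/esym/setIidr; exact: nonvan_sub.
split=> t W WV WE; have [r [k [rE WE']]] := key t W WV WE;
  have WU := subset_trans WV VU.
  apply: (@module_loc_factor _ _ _ (rs_res VU) (rs_res WU) (rs_res WV) _
           _^o _^o _^o (rs_res VU) (rs_res WU) (rs_res WV) s r t k) => //.
  - by move=> a; rewrite rs_res_comp.
  - by move=> a; rewrite rs_res_comp.
  - by move=> a x; exact: rmorphM.
  - by move=> a x; exact: rmorphM.
  - exact: rg.
  - exact: (rg _ _ WU WE').
apply: (@module_loc_factor _ _ _ (rs_res VU) (rs_res WU) (rs_res WV) _
           _ _ _ (sm_res M VU) (sm_res M WU) (sm_res M WV) s r t k) => //.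
- by move=> a; rewrite rs_res_comp.
- by move=> a; rewrite sm_res_comp.
- exact: sm_resZ.
- exact: sm_resZ.
- exact: mg.
- exact: mg.
Qed.

(** * Affine charts *)

Section Chart.
Variables (U : opens X) (c : affine_chart U).

Lemma basic_open_open (A : comPzRingType) (a : A) : open (basic_open a).
Proof.
suff : zariski_open (basic_open a) by [].
exists [set a]; apply/seteqP; split=> p /=; first by move=> na ap; apply/na/ap.
by move=> na pa; apply: na => _ ->.
Qed.

Lemma basic_open_base (A : comPzRingType) (E : set (spectrum A)) p :
  open E -> E p -> exists2 a, basic_open a p & basic_open a `<=` E.
Proof.
move=> oE; have [F ->] : zariski_open E by exact: oE.
move=> /= /existsNP [a /not_implyP [Fa pa]]; exists a => // q qa /= Fq.
exact/qa/Fq.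
Qed.

Definition chart_basic (a : ch_ring c) : opens X :=
  Opens (@ch_open _ _ c _ (basic_open_open a)).

Lemma chart_basic_sub a : chart_basic a `<=` U.
Proof. by move=> x [p _ <-]; rewrite -(ch_range c); exists p. Qed.

Lemma chart_loc a : localization_away
  (rs_res (@chart_basic_sub a) \o ch_mor c : {rmorphism _ -> _}) a.
Proof. exact: ch_loc. Qed.

(** If [a] is invertible on some [D(h)] around the point, then [a e = h ^+ k] up to a
    power of [h], so [a] lies in no prime that avoids [h]. *)
Lemma nonvan_chart a : nonvan (ch_mor c a) = ch_map c @` basic_open a.
Proof.
apply/seteqP; split=> [x xa|x xa]; last first.
  exists (chart_basic a) => //; exists (@chart_basic_sub a).
  by have [[b ab] _ _] := chart_loc a; exists b.
have : opens_set U x by exact: nonvan_sub xa.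
rewrite -(ch_range c) => -[q _ qx]; exists q => //.
have [V aV Vx] := xa.
have [h qh hV] : exists2 h, basic_open h q & basic_open h `<=` ch_map c @^-1` V.
  apply: basic_open_base; last by rewrite /= qx.
  by move/continuousP: (@ch_cts _ _ c); apply; exact: opens_open.
have hV' : chart_basic h `<=` V by move=> y [p /hV /= Vp <-].
have [hU [b ab]] := unit_on_sub hV' aV.
have [_ clr inj] := chart_loc h.
have [e [k eE]] := clr b.
have [|j jE] := inj (a * e) (h ^+ k).
  rewrite rmorphM -eE mulrCA /= (Prop_irrelevance (@chart_basic_sub h) hU) ab mulr1.
  by rewrite !rmorphXn.
move=> qa; apply: qh; apply: (@prime_exp _ q h (j + k)%N).
have [_ _ qM] := prime_ideal q.
by rewrite exprD -jE; apply: (qM); rewrite mulrC; apply: (qM).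
Qed.

Lemma chart_basic1 : U = ch_map c @` basic_open 1 :> set X.
Proof.
rewrite -(ch_range c); congr (_ @` _); apply/seteqP; split=> // p _.
exact: prime_proper.
Qed.

(** Over [D(1)] a chart says that its ring is the ring of sections over [U]. *)
Lemma chart_loc1 : localization_away (ch_mor c) 1.
Proof.
have [_ clr inj] := @ch_loc _ _ c 1 U (@subset_refl _ _) chart_basic1.
split.
- by exists 1; rewrite rmorph1 mul1r.
- move=> b; have [x [k xE]] := clr b; exists x, k; move: xE.
  by rewrite /= rs_res_id => ->; exact: rs_res_id.
- by move=> x y xy; apply: inj; rewrite /= xy.
Qed.

Lemma chart_surj s : exists a, ch_mor c a = s.
Proof.
have [_ clr _] := chart_loc1; have [a [k aE]] := clr s; exists a.
by rewrite -aE rmorph1 expr1n mul1r.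
Qed.

Lemma chart_inj : injective (ch_mor c).
Proof.
have [_ _ inj] := chart_loc1 => a b /inj [k]; by rewrite expr1n !mul1r.
Qed.

Lemma chart_ring_localizing : ring_localizing U.
Proof.
move=> s V VU; have [a <-] := chart_surj s; rewrite nonvan_chart => VE.
have := ch_loc VU VE; set psi := (X in localization_away X a) => psiL.
apply: (@module_loc_factor _ _ _ (ch_mor c) psi (rs_res VU) _
           _^o _^o _^o (ch_mor c) psi (rs_res VU) 1 a _ 0) => //.
- by move=> ? ?; exact: rmorphM.
- by move=> ? ?; exact: rmorphM.
- by rewrite mul1r.
- exact: chart_loc1.
- by rewrite mul1r.
Qed.

Lemma chart_mod_localizing (N : lmodType (ch_ring c))
    (iota : {linear N -> M U | ch_mor c \; *:%R}) :
  (forall (a : ch_ring c) (V : opens X) (VU : V `<=` U),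
        V = ch_map c @` basic_open a :> set X ->
        module_localization_away
          (rs_res VU \o ch_mor c : {rmorphism _ -> _}) (sm_res M VU \o iota) a) ->
  mod_localizing U.
Proof.
move=> H s V VU; have [a <-] := chart_surj s; rewrite nonvan_chart => VE.
have := H a V VU VE; set psi := (X in module_localization_away X) => psiL.
apply: (@module_loc_factor _ _ _ (ch_mor c) psi (rs_res VU) _
           _ _ _ iota (sm_res M VU \o iota) (sm_res M VU) 1 a _ 0) => //.
- by move=> b x; rewrite linearZ.
- exact: sm_resZ.
- by rewrite mul1r.
- have [_ clr inj] := H 1 U (@subset_refl _ _) chart_basic1.
  split.
  + by exists 1; rewrite rmorph1 mul1r.
  + move=> b; have [x [k xE]] := clr b; exists x, k; move: xE.
    by rewrite /= rs_res_id => ->; exact: sm_res_id.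
  + by move=> x y xy; apply: inj; rewrite /= xy.
- by rewrite mul1r.
Qed.

Lemma chart_base x W : opens_set U x -> opens_set W x ->
  exists s : rs_ring U, nonvan s x /\ nonvan s `<=` W.
Proof.
rewrite -(ch_range c) => -[p _ <-] Wx.
have [h ph hW] : exists2 h, basic_open h p & basic_open h `<=` ch_map c @^-1` W.
  apply: basic_open_base => //.
  by move/continuousP: (@ch_cts _ _ c); apply; exact: opens_open.
exists (ch_mor c h); rewrite nonvan_chart; split; first by exists p.
by move=> y [q /hW Wq <-].
Qed.

(** Otherwise some prime contains the ideal generated by [T], and every section of [T]
    vanishes at the corresponding point. *)
Lemma chart_unit_ideal (T : set (rs_ring U)) :
  (forall x, opens_set U x -> exists2 s, T s & nonvan s x) -> unit_ideal T.
Proof.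
move=> cov K idK TK; have [K0 KD KM] := idK; apply: contrapT => K1.
have [||p Kp] := @prime_avoiding_one _ [set a | K (ch_mor c a)].
- split=> /= [|a b Ka Kb|a b Kb]; first by rewrite rmorph0.
  + by rewrite rmorphD; apply: KD.
  + by rewrite rmorphM; apply: KM.
- by rewrite /= rmorph1.
have [|s Ts] := cov (ch_map c p); first by rewrite -(ch_range c); exists p.
have [a aE] := chart_surj s; rewrite -aE nonvan_chart => -[q qa /ch_inj qp].
by apply: qa; rewrite qp; apply: Kp; rewrite /= aE; apply: TK.
Qed.

Lemma chart_cover (I : finType) (f d : I -> rs_ring U) :
  \sum_i d i * f i = 1 -> U `<=` \bigcup_i nonvan (f i).
Proof.
move=> fd x Ux; apply: contrapT => nx.
move: Ux; rewrite -(ch_range c) => -[p _ px].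
have /choice [a aE] := fun i => chart_surj (f i).
have /choice [b bE] := fun i => chart_surj (d i).
apply: (@prime_proper _ p).
have -> : 1 = \sum_i b i * a i.
  apply: chart_inj; rewrite rmorph1 rmorph_sum -fd.
  by apply: eq_bigr => i _; rewrite rmorphM aE bE.
apply: (ideal_sum (prime_ideal p)) => i; have [_ _ pM] := prime_ideal p; apply: (pM).
apply: contrapT => npa; apply: nx; exists i => //.
by rewrite -aE nonvan_chart; exists p.
Qed.

End Chart.

End RingedSpace.

(** * Quasi-coherent sheaves on affine opens *)

Section QuasiCoherent.
Variables (X : scheme) (M : sheaf_of_modules X).
Implicit Types U V W : opens X.

(** The usual gluing argument.  A section over the locus of [s] becomes, after
    multiplication by a power of [s], the restriction of a section over each
    member of the finite cover; these agree on overlaps after multiplication by a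
    further power, because the overlaps are again localizing, and hence glue. *)
Lemma mod_localizing_glue U (I : finType) (f : I -> rs_ring U) :
  ring_localizing U -> U `<=` \bigcup_i nonvan (f i) ->
  (forall i, localizing M (nonvan_opens (f i))) -> mod_localizing M U.
Proof.
move=> rgU Ucov gf s V VU VE.
pose W i := nonvan_opens (f i).
have WU i : W i `<=` U by exact: nonvan_sub.
have Vcov : V `<=` \bigcup_i (opensI V (W i) : set X).
  by move=> x Vx; have [i _ fx] := Ucov x (VU x Vx); exists i.
have VWV i : opensI V (W i) `<=` V by exact: opensIl.
have VWW i : opensI V (W i) `<=` W i by exact: opensIr.
have VWU i : opensI V (W i) `<=` U by exact: subset_trans (VWW i) (WU i).
have VWE i : opensI V (W i) = nonvan (rs_res (WU i) s) :> set X.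
  by rewrite nonvan_res -VE setIC.
have loc i := (gf i).2 _ _ (VWW i) (VWE i).
split; first by have [] := rgU s V VU VE.
- move=> y.
  have nX i : exists n : M (W i), exists k,
      rs_res (VWW i) (rs_res (WU i) s) ^+ k *: sm_res M (VWV i) y = sm_res M (VWW i) n.
    by have [_ clr _] := loc i; exact: clr.
  pose n i := projT1 (cid (nX i)).
  have nE i := projT2 (cid (nX i)).
  have /choice [k kE] := nE.
  pose K := (\sum_i k i)%N.
  pose n' i := rs_res (WU i) s ^+ (K - k i) *: n i.
  have n'E i : sm_res M (VWW i) (n' i) = rs_res (VWU i) s ^+ K *: sm_res M (VWV i) y.
    rewrite sm_resZ -kE scalerA rmorphXn -exprD subnK ?rs_res_comp //.
    by rewrite /K (bigD1 i) //= leq_addr.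
  clearbody n'.
  pose W2 i j := opensI (W i) (W j).
  have W2l i j : W2 i j `<=` W i by exact: opensIl.
  have W2r i j : W2 i j `<=` W j by exact: opensIr.
  have W2U i j : W2 i j `<=` U by exact: subset_trans (W2l i j) (WU i).
  have gW2 i j : localizing M (W2 i j).
    by apply: (localizing_nonvan (s := rs_res (WU i) (f j)) (gf i)); rewrite nonvan_res.
  have /choice [l lE] : forall p : I * I, exists l,
      rs_res (W2U p.1 p.2) s ^+ l *: sm_res M (W2l p.1 p.2) (n' p.1) =
      rs_res (W2U p.1 p.2) s ^+ l *: sm_res M (W2r p.1 p.2) (n' p.2).
    move=> [i j] /=.
    pose V2 := nonvan_opens (rs_res (W2U i j) s).
    have V2W2 : V2 `<=` W2 i j by exact: nonvan_sub.
    have [_ _ inj] := (gW2 i j).2 _ V2 V2W2 erefl; apply: inj.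
    have V2i : V2 `<=` opensI V (W i).
      move=> x xV2; split; last by have [] := V2W2 x xV2.
      by move: xV2; rewrite /V2 /= nonvan_res -VE => -[].
    have V2j : V2 `<=` opensI V (W j).
      move=> x xV2; split; last by have [] := V2W2 x xV2.
      by move: xV2; rewrite /V2 /= nonvan_res -VE => -[].
    have V2V : V2 `<=` V by exact: subset_trans V2i (VWV i).
    rewrite (sm_res_comp _ _ (subset_trans V2i (VWW i))) -(sm_res_comp (VWW i) V2i).
    rewrite (sm_res_comp _ _ (subset_trans V2j (VWW j))) -(sm_res_comp (VWW j) V2j).
    rewrite !n'E !sm_resZ !rmorphXn.
    by rewrite !(sm_res_comp _ _ V2V) !(rs_res_comp _ _ (subset_trans V2V VU)).
  pose L := (\sum_p l p)%N.
  have [t tE] : exists t : M U, forall i, sm_res M (WU i) t = rs_res (WU i) s ^+ L *: n' i.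
    apply: sm_glue => // i j.
    rewrite !sm_resZ !rmorphXn !(rs_res_comp _ _ (W2U i j)).
    have lL : (l (i, j) <= L)%N by rewrite /L (bigD1 (i, j)) //= leq_addr.
    rewrite -(subnK lL) exprD -!scalerA; congr (_ *: _).
    rewrite (Prop_irrelevance (@opensIl _ (W i) (W j)) (W2l i j)).
    rewrite (Prop_irrelevance (@opensIr _ (W i) (W j)) (W2r i j)).
    exact: (lE (i, j)).
  exists t, (L + K)%N; apply: (sm_separated (WU := VWV) Vcov) => i.
  rewrite (sm_res_comp _ _ (VWU i)) -(sm_res_comp (WU i) (VWW i)) tE !sm_resZ n'E.
  by rewrite !rmorphXn !(rs_res_comp _ _ (VWU i)) scalerA -exprD.
- move=> x y xy.
  have /choice [k kE] : forall i, exists k, rs_res (WU i) s ^+ k *: sm_res M (WU i) x =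
                                   rs_res (WU i) s ^+ k *: sm_res M (WU i) y.
    move=> i; have [_ _ inj] := loc i; apply: inj.
    by rewrite !(sm_res_comp _ _ (VWU i)) -!(sm_res_comp VU (VWV i)) xy.
  exists (\sum_i k i)%N; apply: (sm_separated (WU := WU) Ucov) => i.
  have kK : (k i <= \sum_i k i)%N by rewrite (bigD1 i) //= leq_addr.
  by rewrite !sm_resZ !rmorphXn -(subnK kK) exprD -!scalerA kE.
Qed.

Hypothesis M_qc : quasi_coherent M.

(** The point has a basic neighbourhood [D(g)] in a chart on which [M] is given by a
    module, inside [U], and then a basic neighbourhood [D(f)] in [U], inside [D(g)]. *)
Lemma localizing_nbhs U (c : affine_chart U) x : opens_set U x ->
  exists f : rs_ring U, nonvan f x /\ localizing M (nonvan_opens f).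
Proof.
move=> Ux; have [U' [c' [U'x [N [iota Niota]]]]] := M_qc x.
have gU' : localizing M U'.
  by split; [exact: chart_ring_localizing | exact: chart_mod_localizing Niota].
have [g [gx gU]] := chart_base c' U'x Ux.
have [f [fx fg]] := chart_base c (W := nonvan_opens g) Ux gx.
exists f; split=> //.
apply: (@localizing_nonvan _ M (nonvan_opens g)
          (rs_res (gU : nonvan_opens g `<=` U) f) (nonvan_opens f)) => /=.
  exact: localizing_nonvan gU' _.
by rewrite nonvan_res /=; apply/esym/setIidr.
Qed.

Lemma affine_localizing U : affine U -> localizing M U.
Proof.
move=> [c]; have rgU := chart_ring_localizing c; split=> //.
have [|k [f [d [gf fd]]]] :=
    @unit_ideal_finite _ [set f : rs_ring U | localizing M (nonvan_opens f)].
  apply: (chart_unit_ideal c) => x Ux.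
  by have [f [fx gf]] := localizing_nbhs c Ux; exists f.
by apply: mod_localizing_glue gf => //; apply: chart_cover fd.
Qed.

End QuasiCoherent.

Unset Implicit Arguments.

Theorem theorem4p6 (n : nat) (n_ge1 : (1 <= n)%N)
    (X : scheme) (X_noeth : locally_noetherian X)
    (M : sheaf_of_modules X) (M_qc : quasi_coherent M)
    (V : set (opens X))
    (V_affine : forall v : opens X, V v -> affine v)
    (V_cover : \bigcup_(v in V) opens_set v = [set: X])
    (V_fml : forall v : opens X, V v -> flat_mittag_leffler n (M v)) :
  drinfeld_vector_bundle n M.
Proof.
move=> U affU; have gU := affine_localizing M_qc affU; have [c] := affU.
apply: (flat_ml_descent (S := [set f | flat_ml_at n (M U) f])) => //.
apply: (chart_unit_ideal c) => x Ux.
have : [set: X] x by []; rewrite -V_cover => -[v Vv vx].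
have gv := affine_localizing M_qc (V_affine v Vv); have [cv] := V_affine v Vv.
have [g [gx gU']] := chart_base cv vx Ux.
(* From [v] to [D(g)] inside [v], then to [D(f)], which is basic open both in
   [D(g)] and in [U]. *)
pose W := nonvan_opens g.
have [Wloc WM] := localizing_is_loc (V := W) (@nonvan_sub _ _ g) gv erefl.
have fmlW := flat_ml_localize Wloc WM (V_fml v Vv).
have [f [fx fW]] := chart_base c (W := W) Ux gx.
pose Wf := nonvan_opens f.
have WfE : Wf = nonvan (rs_res (gU' : W `<=` U) f) :> set X.
  by rewrite nonvan_res; apply/esym/setIidr.
have [fWloc fWM] := localizing_is_loc (fW : Wf `<=` W) (localizing_nonvan (V := W) gv erefl) WfE.
have [fUloc fUM] := localizing_is_loc (V := Wf) (@nonvan_sub _ _ f) gU erefl.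
exists f => //; exists (rs_ring Wf), (rs_res (@nonvan_sub _ _ f : Wf `<=` U)), (M Wf).
exists (sm_res M (@nonvan_sub _ _ f : Wf `<=` U)); split=> //.
exact (flat_ml_localize fWloc fWM fmlW).
Qed.
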